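(* Let $G$ be a Gurarij space, and let $E \subseteq G$ be a separable subspace. Then the following are equivalent: (1) The space $G$ is prime over $E$. (2) The space $G$ is separable and atomic over $E$.
   Context: All spaces are real; embeddings of normed spaces are linear and isometric. Subspaces are Banach spaces (closed). Types. For a Banach space $E$ and $n \in \mathbb{N}$, let $E(n) = E \oplus \bigoplus_{i<n} \mathbb{R} x_i$, with formal variables $x_i$. The space of $n$-types $S_n(E)$ is the set of all semi-norms on $E(n)$ extending the norm of $E$; the semi-norm corresponding to $\xi \in S_n(E)$ is written $\|\cdot\|^\xi$. If $E \subseteq F$ are Banach spaces and $\bar a \in F^n$, then $\mathrm{tp}(\bar a/E) \in S_n(E)$ is the semi-norm $b + \sum \lambda_i x_i \mapsto \| b + \sum \lambda_i a_i \|$; $\bar a$ realises $\xi$ if $\xi = \mathrm{tp}(\bar a/E)$. The topology on $S_n(E)$ is the least one making $\xi \mapsto \|x\|^\xi$ continuous for every $x \in E(n)$. The distance $d(\xi,\zeta)$ is the infimum, over all Banach spaces $F \supseteq E$ and all realisations $\bar a,\bar b \in F^n$ of $\xi,\zeta$ respectively, of $\sup_i \|a_i - b_i\|$. A type $\xi$ is isolated if every metric neighbourhood of $\xi$ is also a neighbourhood of $\xi$ in the topology. For $E \subseteq F$, $F$ is atomic over $E$ if the type over $E$ of every finite tuple in $F$ is isolated. A Gurarij space is a Banach space $G$ such that for any $\varepsilon > 0$, finite-dimensional Banach spaces $E \subseteq F$ and isometric embedding $\varphi \colon E \to G$, there is a linear map $\psi \colon F \to G$ extending $\varphi$ with $(1-\varepsilon)\|x\|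 \leq \|\psi x\| \leq (1+\varepsilon)\|x\|$ for all $x \in F$. A Gurarij space $G$ is prime over a separable subspace $E$ if it embeds isometrically over $E$ (i.e., by an embedding restricting to the identity on $E$) in every Gurarij space containing $E$. *)

(* Defs.v *)
From HB Require Import structures.
From mathcomp Require Import all_boot all_order all_algebra.
From mathcomp Require Import boolp classical_sets functions cardinality.
From mathcomp Require Import reals ereal topology normedtype.

Set Implicit Arguments.
Unset Strict Implicit.
Unset Printing Implicit Defensive.

Import Order.TTheory GRing.Theory Num.Theory.
Import numFieldNormedType.Exports.

Local Open Scope classical_set_scope.
Local Open Scope ring_scope.

(* An inclusion of Banach spaces is rendered by a linear isometric embedding
   of complete normed modules; "over E" means commuting with the embeddings
   of E. *)
Record embedding (R : realType) (E F : completeNormedModType R) := Embedding {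
  emb_linear :> {linear E -> F};
  emb_isometric : forall x : E, `|emb_linear x| = `|x| }.

Definition separable (T : topologicalType) : Prop :=
  exists2 A : set T, countable A & dense A.

Definition finite_dimensional (R : realType) (E : completeNormedModType R) :
    Prop :=
  exists (n : nat) (b : 'I_n -> E),
    forall x : E, exists c : 'I_n -> R, x = \sum_(i < n) c i *: b i.

Definition seminorm (R : realType) (V : lmodType R) (p : V -> R) : Prop :=
  (forall x y : V, p (x + y) <= p x + p y) /\
  (forall (a : R) (x : V), p (a *: x) = `|a| * p x).

(* E(n): the pair (b, l) stands for the formal sum b + \sum_i l_i x_i. *)
Definition formal_ext (R : realType) (E : completeNormedModType R) (n : nat) :
    lmodType R :=
  (E * 'rV[R]_n)%type.

Record ntype (R : realType) (E : completeNormedModType R) (n : nat) := NType {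
  ntype_norm :> formal_ext E n -> R;
  ntype_seminorm : seminorm ntype_norm;
  ntype_extends : forall b : E, ntype_norm (b, 0) = `|b| }.

HB.instance Definition _ (R : realType) (E : completeNormedModType R)
    (n : nat) :=
  gen_eqMixin (ntype E n).
HB.instance Definition _ (R : realType) (E : completeNormedModType R)
    (n : nat) :=
  gen_choiceMixin (ntype E n).

(* The coarsest topology making every evaluation xi |-> xi x continuous. *)
HB.instance Definition _ (R : realType) (E : completeNormedModType R)
    (n : nat) :=
  Topological.copy (ntype E n)
    (sup_topology (fun x : formal_ext E n =>
       Topological.on (initial_topology (fun xi : ntype E n => xi x : R)))).

Definition eval_tuple (R : realType) (E F : completeNormedModType R)
    (j : embedding E F) (n : nat) (a : 'I_n -> F) (x : formal_ext E n) : F :=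
  j x.1 + \sum_(i < n) x.2 0 i *: a i.

Lemma tp_seminorm (R : realType) (E F : completeNormedModType R)
    (j : embedding E F) (n : nat) (a : 'I_n -> F) :
  seminorm (fun x : formal_ext E n => `|eval_tuple j a x|).
Proof.
split=> [x y|c x]; rewrite /eval_tuple.
  have -> : j (x + y).1 + \sum_(i < n) (x + y).2 0 i *: a i =
      (j x.1 + \sum_(i < n) x.2 0 i *: a i) +
      (j y.1 + \sum_(i < n) y.2 0 i *: a i).
    rewrite linearD addrACA -big_split /=; congr (_ + _).
    by apply: eq_bigr => i _; rewrite mxE scalerDl.
  exact: ler_normD.
rewrite -normrZ linearZ scalerDr scaler_sumr; congr (`| _ + _ |).
by apply: eq_bigr => i _; rewrite mxE scalerA.
Qed.

Lemma tp_extends (R : realType) (E F : completeNormedModType R)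
    (j : embedding E F) (n : nat) (a : 'I_n -> F) (b : E) :
  `|eval_tuple j a (b, 0)| = `|b|.
Proof.
rewrite /eval_tuple big1 ?addr0 ?emb_isometric// => i _.
by rewrite mxE scale0r.
Qed.

Definition tp (R : realType) (E F : completeNormedModType R)
    (j : embedding E F) (n : nat) (a : 'I_n -> F) : ntype E n :=
  NType (tp_seminorm j a) (tp_extends j a).

Definition realises (R : realType) (E F : completeNormedModType R)
    (j : embedding E F) (n : nat) (a : 'I_n -> F) (xi : ntype E n) : Prop :=
  xi = tp j a.

Definition sup_dist (R : realType) (F : completeNormedModType R) (n : nat)
    (a b : 'I_n -> F) : R :=
  \big[Order.max/0]_(i < n) `|a i - b i|.

Definition type_dist (R : realType) (E : completeNormedModType R) (n : nat)
    (xi zeta : ntype E n) : \bar R :=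
  ereal_inf [set r : \bar R |
    exists (F : completeNormedModType R) (j : embedding E F)
      (a b : 'I_n -> F),
      [/\ realises j a xi, realises j b zeta & r = (sup_dist a b)%:E]].

Definition metric_nbhs (R : realType) (E : completeNormedModType R) (n : nat)
    (xi : ntype E n) : set_system (ntype E n) :=
  filter_from [set r : R | 0 < r]
    (fun r => [set zeta | (type_dist xi zeta < r%:E)%E]).

Definition isolated_type (R : realType) (E : completeNormedModType R)
    (n : nat) (xi : ntype E n) : Prop :=
  metric_nbhs xi `<=` nbhs xi.

Definition atomic_over (R : realType) (E F : completeNormedModType R)
    (j : embedding E F) : Prop :=
  forall (n : nat) (a : 'I_n -> F), isolated_type (tp j a).

Definition gurarij (R : realType) (G : completeNormedModType R) : Prop :=
  forall (eps : R), 0 < eps ->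
  forall (E F : completeNormedModType R) (j : embedding E F)
    (phi : embedding E G),
    finite_dimensional E -> finite_dimensional F ->
    exists psi : {linear F -> G},
      (forall x : E, psi (j x) = phi x) /\
      (forall x : F, (1 - eps) * `|x| <= `|psi x| <= (1 + eps) * `|x|).

Definition prime_over (R : realType) (E G : completeNormedModType R)
    (j : embedding E G) : Prop :=
  forall (H : completeNormedModType R) (k : embedding E H),
    gurarij H ->
    exists f : embedding G H, forall x : E, f (j x) = k x.

(* Main.v *)
Require Import Defs.
From HB Require Import structures.
From mathcomp Require Import all_boot all_order all_algebra.
From mathcomp Require Import boolp classical_sets reals topology normedtype.
From mathcomp Require Import cardinality ereal.
From mathcomp Require Import lra.

(** Two quantitative facts about types underlie both implications.  First,
    the distance between types has a closed form: [d(xi, zeta) <= r] if and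
    only if [|xi x - zeta x| <= r * l1(x)] for all formal vectors [x],
    where [l1] is the l1 norm of the coefficients of the variables
    ([type_dist_lt], [type_dist_le]).  The nontrivial direction amalgamates
    the two types over [E]; like every amalgam below it is a quotient
    seminorm ([qsn]) turned into a Banach space by completion.  Secondly,
    by finite-dimensionality, the definition of Gurarij spaces says that
    every seminorm on formal combinations that restricts correctly is
    realised in the space with an arbitrarily small relative error
    ([gurarij_realise]).

    Atomic implies prime.  Let [a] be a dense sequence in [G] and [H] a
    Gurarij space over [E].  If [b] in [H] nearly realises the type of [a
    0, ..., a (m-1)], then some [b'], close to [b], nearly realises the
    type of one more term of [a] with an even smaller error: that type is
    isolated, so that being close to it in distance is implied by finitely
    many inequalities, and these are a finite-dimensional demand on [H]
    ([close_types_step]).  Iterating and passing to the limit embeds [G]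
    into [H] over [E] ([separable_atomic_prime]).

    Prime implies separable and atomic.  It is enough to find, for each
    non-isolated type [xi] over [E], a separable Gurarij space over [E]
    that omits [xi]: as [G] embeds into it over [E], such a space shows
    that [G] is separable and that no tuple of [G] has type [xi].  It is
    the completion of [E * {poly R}], the monomials serving as variables,
    for a generic seminorm: one that meets countably many dense sets of
    conditions ([generic_seminorm]).  Meeting suitable dense sets makes the
    variables dense and the completion Gurarij ([generic_rich],
    [rich_gurarij]).  It remains to see that the conditions that keep a
    given tuple of variables metrically away from [xi] are dense
    ([omits_dense]).  Given a condition that leaves the tuple close to
    [xi], some type [eta] nearly agrees with [xi] as far as the finitely
    many vectors of the condition can tell, but is far from [xi] in
    distance, because [xi] is not isolated.  Amalgamating the condition
    with [eta] hardly changes it, and makes the tuple have a type close to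
    [eta], hence far from [xi] ([omitting_amalgam]).  As the variables are
    dense, no tuple at all realises [xi]. *)

Set Implicit Arguments.
Unset Strict Implicit.
Unset Printing Implicit Defensive.

Import Order.TTheory GRing.Theory Num.Theory.
Import numFieldNormedType.Exports.

Local Open Scope classical_set_scope.
Local Open Scope ring_scope.

(** * Seminorms *)

Section LinearMaps.
Variables (R : realType) (U V : lmodType R) (T : U -> V) (hT : linear T).

Definition lin_pack : {linear U -> V} :=
  HB.pack T (GRing.isLinear.Build R U V *:%R T hT).

Lemma linD x y : T (x + y) = T x + T y. Proof. exact: (linearD lin_pack). Qed.
Lemma linB x y : T (x - y) = T x - T y. Proof. exact: (linearB lin_pack). Qed.
Lemma linN x : T (- x) = - T x. Proof. exact: (linearN lin_pack). Qed.
Lemma linZ a x : T (a *: x) = a *: T x. Proof. exact: (linearZZ lin_pack). Qed.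
Lemma lin0 : T 0 = 0. Proof. exact: (linear0 lin_pack). Qed.

Lemma lin_bundle : exists T' : {linear U -> V}, T' =1 T.
Proof. by exists lin_pack. Qed.

End LinearMaps.

Section LinearConstructions.
Variable R : realType.
Implicit Types U V W : lmodType R.

Lemma linear_compose U V W (S : V -> W) (T : U -> V) :
  linear S -> linear T -> linear (fun x => S (T x)).
Proof. by move=> hS hT a x y; rewrite hT hS. Qed.

Lemma linear_id U : linear (fun x : U => x).
Proof. by []. Qed.

Lemma linear_0 U V : linear (fun _ : U => 0 : V).
Proof. by move=> a x y; rewrite scaler0 addr0. Qed.

Lemma linear_pair U V W (S : U -> V) (T : U -> W) :
  linear S -> linear T -> linear (fun x => (S x, T x)).
Proof. by move=> hS hT a x y; rewrite hS hT. Qed.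

Lemma linear_fst U V : linear (fun x : U * V => x.1).
Proof. by []. Qed.

Lemma linear_snd U V : linear (fun x : U * V => x.2).
Proof. by []. Qed.

Lemma linear_add U V (S T : U -> V) :
  linear S -> linear T -> linear (fun x => S x + T x).
Proof. by move=> hS hT a x y; rewrite hS hT /= scalerDr addrACA. Qed.

Lemma linear_opp U V (S : U -> V) : linear S -> linear (fun x => - S x).
Proof. by move=> hS a x y; rewrite hS /= opprD scalerN. Qed.

End LinearConstructions.

Section Seminorms.
Variables (R : realType) (V : lmodType R) (p : V -> R) (hp : seminorm p).

Lemma snD x y : p (x + y) <= p x + p y. Proof. by case: hp. Qed.
Lemma snZ a x : p (a *: x) = `|a| * p x. Proof. by case: hp. Qed.
Lemma sn0 : p 0 = 0. Proof. by rewrite -(scale0r 0) snZ normr0 mul0r. Qed.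
Lemma snN x : p (- x) = p x.
Proof. by rewrite -scaleN1r snZ normrN1 mul1r. Qed.
Lemma snB x y : p (x - y) <= p x + p y.
Proof. by rewrite -(snN y) snD. Qed.
Lemma snC x y : p (x - y) = p (y - x).
Proof. by rewrite -snN opprB. Qed.
Lemma sn_ge0 x : 0 <= p x.
Proof. by have := snB x x; rewrite subrr sn0; lra. Qed.
Lemma snDB x y : p x <= p (x + y) + p y.
Proof. by have := snB (x + y) y; rewrite addrK. Qed.
Lemma sn_tri x y z : p (x - z) <= p (x - y) + p (y - z).
Proof. by have := snD (x - y) (y - z); rewrite addrA subrK. Qed.
Lemma sn_le x y : p x <= p y + p (x - y).
Proof. by have := snD y (x - y); rewrite addrC subrK. Qed.
Lemma sn_dist x y : `|p x - p y| <= p (x - y).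
Proof.
rewrite ler_norml; apply/andP; split; last by have := sn_le x y; lra.
by have := sn_le y x; rewrite (snC y); lra.
Qed.
Lemma sn_sum (I : Type) (r : seq I) (F : I -> V) :
  p (\sum_(i <- r) F i) <= \sum_(i <- r) p (F i).
Proof.
elim: r => [|i r IH]; first by rewrite !big_nil sn0.
by rewrite !big_cons; have := snD (F i) (\sum_(j <- r) F j); lra.
Qed.

End Seminorms.

Section SeminormConstructions.
Variable R : realType.

Lemma scale_bound (a e : R) : 0 < e -> exists2 d, 0 < d & `|a| * d <= e.
Proof.
move=> e0; have a0 : 0 < `|a| + 1 by have := normr_ge0 a; lra.
exists (e / (`|a| + 1)); first exact: divr_gt0.
by rewrite mulrCA ler_piMr ?(ltW e0)// ler_pdivrMr// mul1r; lra.
Qed.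

Lemma seminorm_comp (U V : lmodType R) (p : V -> R) (T : U -> V) :
  seminorm p -> linear T -> seminorm (fun x => p (T x)).
Proof.
move=> hp hT; split=> [x y|a x].
  by rewrite (linD hT); apply: snD.
by rewrite (linZ hT) snZ.
Qed.

Lemma seminorm_add (V : lmodType R) (p q : V -> R) :
  seminorm p -> seminorm q -> seminorm (fun x => p x + q x).
Proof.
move=> hp hq; split=> [x y|a x]; last by rewrite (snZ hp) (snZ hq) mulrDr.
by have := snD hp x y; have := snD hq x y; lra.
Qed.

Lemma seminorm_scale (V : lmodType R) (p : V -> R) (c : R) :
  0 <= c -> seminorm p -> seminorm (fun x => c * p x).
Proof.
move=> c0 hp; split=> [x y|a x]; last by rewrite (snZ hp) mulrCA.
by rewrite -mulrDr ler_wpM2l// (snD hp).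
Qed.

Lemma seminorm_norm (V : normedModType R) : seminorm (fun x : V => `|x|).
Proof. by split=> [x y|a x]; rewrite ?ler_normD ?normrZ. Qed.

(** The quotient seminorm by the range of [T].  Every amalgam of seminorms
    below is a quotient of a sum of seminorms on a product space. *)
Definition qsn (Y Z : lmodType R) (Q : Y -> R) (T : Z -> Y) (y : Y) : R :=
  inf [set Q (y + T z) | z in [set: Z]].

Section Quotient.
Variables (Y Z : lmodType R) (Q : Y -> R) (T : Z -> Y).
Hypotheses (hQ : seminorm Q) (hT : linear T).

Lemma qsn_le y z : qsn Q T y <= Q (y + T z).
Proof.
apply: ge_inf; last by exists z.
by exists 0 => _ [w _ <-]; apply: (sn_ge0 hQ).
Qed.

Lemma qsn_ge y a : (forall z, a <= Q (y + T z)) -> a <= qsn Q T y.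
Proof.
move=> ha; apply: lb_le_inf; first by exists (Q (y + T 0)); exists 0.
by move=> _ [z _ <-].
Qed.

Lemma qsn_le0 y : qsn Q T y <= Q y.
Proof. by have := qsn_le y 0; rewrite (lin0 hT) addr0. Qed.

Lemma qsn_ex y e : 0 < e -> exists z, Q (y + T z) <= qsn Q T y + e.
Proof.
move=> e0; apply: contrapT => hne.
suff : qsn Q T y + e <= qsn Q T y by lra.
apply: qsn_ge => z; apply/ltW; rewrite ltNge; apply/negP => hz.
by apply: hne; exists z.
Qed.

Lemma seminorm_qsn : seminorm (qsn Q T).
Proof.
have scaled a x : qsn Q T (a *: x) <= `|a| * qsn Q T x.
  apply/ler_addgt0Pr => e e0.
  have [b b0 ab] := scale_bound a e0; have [z hz] := qsn_ex x b0.
  apply: le_trans (qsn_le _ (a *: z)) _.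
  rewrite (linZ hT) -scalerDr (snZ hQ).
  apply: le_trans (ler_wpM2l (normr_ge0 a) hz) _.
  by rewrite mulrDr lerD2l.
split=> [x y|a x].
  apply/ler_addgt0Pr => e e0; have e20 : 0 < e / 2 by lra.
  have [z hz] := qsn_ex x e20; have [w hw] := qsn_ex y e20.
  have := qsn_le (x + y) (z + w); rewrite (linD hT) addrACA.
  by have := snD hQ (x + T z) (y + T w); lra.
apply/eqP; rewrite eq_le scaled/=.
have [->|a0] := eqVneq a 0.
  by rewrite normr0 mul0r; apply: qsn_ge => z; apply: (sn_ge0 hQ).
have := scaled a^-1 (a *: x); rewrite scalerA mulVf// scale1r normfV.
by rewrite mulrC ler_pdivlMr ?normr_gt0// mulrC.
Qed.

End Quotient.
End SeminormConstructions.

(** * Completion of a seminormed space *)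

(** The point [x] of the completion is encoded by the function giving its
    distance to the points of [V]: this is a function [f] with
    [|f u - f v| <= p (u - v) <= f u + f v] and infimum [0], and such a
    function determines [x], so that no quotient has to be formed. *)
Record katetov (R : realType) (V : lmodType R) (p f : V -> R) : Prop :=
  Katetov {
    kat_le : forall u v, f u <= f v + p (u - v);
    kat_ge : forall u v, p (u - v) <= f u + f v;
    kat_inf : forall e, 0 < e -> exists u, f u <= e }.

Record completion (R : realType) (V : lmodType R) (p : V -> R)
    (hp : seminorm p) := Completion {
  cdist :> V -> R;
  cdistP : katetov p cdist }.

HB.instance Definition _ (R : realType) (V : lmodType R) (p : V -> R)
  (hp : seminorm p) := gen_eqMixin (completion hp).
HB.instance Definition _ (R : realType) (V : lmodType R) (p : V -> R)
  (hp : seminorm p) := gen_choiceMixin (completion hp).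

Section Completion.
Variables (R : realType) (V : lmodType R) (p : V -> R) (hp : seminorm p).
Local Notation B := (completion hp).
Implicit Types (f g h : B) (u v w : V).

Lemma cdist_ge0 f u : 0 <= f u.
Proof. by have := kat_ge (cdistP f) u u; rewrite subrr (sn0 hp); lra. Qed.

Lemma completion_eq f g :
  (forall e, 0 < e -> exists u, f u <= e /\ g u <= e) -> f = g.
Proof.
move=> hfg; suff fg : cdist f = cdist g.
  case: f g fg {hfg} => [f hf] [g hg] /= fg.
  by move: hf; rewrite fg => hf; congr Completion; exact: Prop_irrelevance.
have H f1 g1 : (forall e, 0 < e -> exists u, cdist f1 u <= e /\ cdist g1 u <= e)
    -> forall v, cdist f1 v <= cdist g1 v.
  move=> h v; apply/ler_addgt0Pr => e e0.
  have [|u [fu gu]] := h (e / 2); first lra.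
  have := kat_le (cdistP f1) v u; have := kat_ge (cdistP g1) v u; lra.
apply/funext => v; apply/eqP; rewrite eq_le !H// => e /hfg[u [fu gu]].
by exists u.
Qed.

(** Here [A u e] is read: the point to be defined is at distance at most [e]
    from [u].  Sums, multiples and limits of Cauchy filters are all obtained
    from such coherent families of approximations. *)
Lemma completion_of_approx (A : V -> R -> Prop) :
  (forall e, 0 < e -> exists u, A u e) ->
  (forall u e u' e', A u e -> A u' e' -> p (u - u') <= e + e') ->
  exists f : B, forall u e, A u e -> f u <= e.
Proof.
move=> Aex Acoh.
pose S v := [set p (v - ue.1) + ue.2 | ue in [set ue | A ue.1 ue.2]].
have A0 u e : A u e -> 0 <= e.
  by move=> Aue; have := Acoh _ _ _ _ Aue Aue; rewrite subrr (sn0 hp); lra.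
have lb v u e : A u e -> inf (S v) <= p (v - u) + e.
  move=> Aue; apply: ge_inf; last by exists (u, e).
  exists 0 => _ [[u' e'] /= /A0 e'0 <-].
  by have := sn_ge0 hp (v - u'); lra.
have S0 v : nonempty (S v).
  by have [u Au] := Aex _ (@ltr01 R); exists (p (v - u) + 1); exists (u, 1).
have hk : katetov p (fun v => inf (S v)).
  split=> [u v|u v|e e0].
  - rewrite -lerBlDr; apply: lb_le_inf => // _ [[w e] /= Awe <-].
    by have := lb u w e Awe; have := sn_tri hp u v w; lra.
  - rewrite -lerBlDr; apply: lb_le_inf => // _ [[w e] /= Awe <-].
    rewrite lerBlDr -lerBlDl.
    apply: lb_le_inf => // _ [[w' e'] /= Awe' <-].
    have := Acoh _ _ _ _ Awe Awe'; have := sn_tri hp u w v.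
    by have := sn_tri hp w w' v; have := snC hp v w'; lra.
  - have [u Au] := Aex _ e0; exists u.
    by have := lb u u e Au; rewrite subrr (sn0 hp) add0r.
by exists (Completion hp hk) => u e /(lb u); rewrite subrr (sn0 hp) add0r.
Qed.

Lemma katetov_embed x : katetov p (fun u => p (u - x)).
Proof.
split=> [u v|u v|e e0]; first by have := sn_tri hp u v x; lra.
  by have := sn_tri hp u x v; rewrite (snC hp v); lra.
by exists x; rewrite subrr (sn0 hp) ltW.
Qed.

Definition cembed x : B := Completion hp (katetov_embed x).

Lemma cembedE x : cembed x x = 0.
Proof. by rewrite /= subrr (sn0 hp). Qed.

Lemma cadd_ex f g : exists h, forall u v, h (u + v) <= f u + g v.
Proof.
pose A w e := exists u v, w = u + v /\ f u + g v <= e.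
have [|w e w' e'|h hh] := @completion_of_approx A.
- move=> e e0; have e20 : 0 < e / 2 by lra.
  have [u fu] := kat_inf (cdistP f) e20.
  have [v gv] := kat_inf (cdistP g) e20.
  by exists (u + v), u, v; split=> //; lra.
- move=> [u [v [-> h1]]] [u' [v' [-> h2]]].
  have := snD hp (u - u') (v - v'); rewrite addrACA -opprD.
  by have := kat_ge (cdistP f) u u'; have := kat_ge (cdistP g) v v'; lra.
- by exists h => u v; apply: hh; exists u, v.
Qed.

Definition cadd f g : B := projT1 (cid (cadd_ex f g)).
Lemma caddP f g u v : cadd f g (u + v) <= f u + g v.
Proof. by rewrite /cadd; case: cid. Qed.

Lemma cscale_ex a f : exists h : B, forall u, h (a *: u) <= `|a| * f u.
Proof.
pose A w e := exists u, w = a *: u /\ `|a| * f u <= e.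
have [|w e w' e'|h hh] := @completion_of_approx A.
- move=> e e0; have [b b0 ab] := scale_bound a e0.
  have [u fu] := kat_inf (cdistP f) b0.
  exists (a *: u), u; split=> //.
  exact: le_trans (ler_wpM2l (normr_ge0 a) fu) ab.
- move=> [u [-> h1]] [u' [-> h2]].
  rewrite -scalerBr (snZ hp).
  have := ler_wpM2l (normr_ge0 a) (kat_ge (cdistP f) u u').
  by rewrite mulrDr; lra.
- by exists h => u; apply: hh; exists u.
Qed.

Definition cscale a f : B := projT1 (cid (cscale_ex a f)).
Lemma cscaleP a f u : cscale a f (a *: u) <= `|a| * f u.
Proof. by rewrite /cscale; case: cid. Qed.

Lemma capprox f e : 0 < e -> exists u, f u <= e.
Proof. exact: kat_inf (cdistP f) _. Qed.

Lemma caddA : associative cadd.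
Proof.
move=> f g h; apply: completion_eq => e e0; have e30 : 0 < e / 3 by lra.
have [u fu] := capprox f e30; have [v gv] := capprox g e30.
have [w hw] := capprox h e30; exists (u + (v + w)); split.
  by have := caddP f (cadd g h) u (v + w); have := caddP g h v w; lra.
have := caddP (cadd f g) h (u + v) w; have := caddP f g u v.
by rewrite addrA; lra.
Qed.

Lemma caddC : commutative cadd.
Proof.
move=> f g; apply: completion_eq => e e0; have e20 : 0 < e / 2 by lra.
have [u fu] := capprox f e20; have [v gv] := capprox g e20; exists (u + v).
split; first by have := caddP f g u v; lra.
by have := caddP g f v u; rewrite addrC; lra.
Qed.

Lemma cadd0 : left_id (cembed 0) cadd.
Proof.
move=> f; apply: completion_eq => e e0; have [u fu] := capprox f e0.
exists (0 + u); split; last by rewrite add0r.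
by have := caddP (cembed 0) f 0 u; rewrite cembedE; lra.
Qed.

Lemma caddN : left_inverse (cembed 0) (cscale (-1)) cadd.
Proof.
move=> f; apply: completion_eq => e e0; have e20 : 0 < e / 2 by lra.
have [u fu] := capprox f e20; exists (-1 *: u + u).
have := caddP (cscale (-1) f) f (-1 *: u) u; have := cscaleP (-1) f u.
rewrite normrN1 mul1r; split; first lra.
by rewrite scaleN1r addNr cembedE ltW.
Qed.

HB.instance Definition _ := GRing.isZmodule.Build B caddA caddC cadd0 caddN.

Lemma cDP f g u v : (f + g) (u + v) <= f u + g v.
Proof. exact: caddP. Qed.

Lemma cscaleA a b f : cscale a (cscale b f) = cscale (a * b) f.
Proof.
apply: completion_eq => e e0.
have [c c0 abc] := scale_bound (a * b) e0; have [u fu] := capprox f c0.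
have H : `|a * b| * f u <= e.
  exact: le_trans (ler_wpM2l (normr_ge0 _) fu) abc.
exists (a *: (b *: u)); split; last first.
  by rewrite scalerA; apply: le_trans (cscaleP _ _ _) _.
apply: le_trans (cscaleP _ _ _) _.
apply: le_trans (ler_wpM2l (normr_ge0 a) (cscaleP b f u)) _.
by rewrite mulrA -normrM.
Qed.

Lemma cscale1 : left_id 1 cscale.
Proof.
move=> f; apply: completion_eq => e e0; have [u fu] := capprox f e0.
exists (1 *: u); split; last by rewrite scale1r.
by have := cscaleP 1 f u; rewrite normr1 mul1r; lra.
Qed.

Lemma cscaleDr : right_distributive cscale +%R.
Proof.
move=> a f g; apply: completion_eq => e e0.
have [|d d0 ad] := @scale_bound R a (e / 2); first lra.
have [u fu] := capprox f d0; have [v gv] := capprox g d0.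
have hf := ler_wpM2l (normr_ge0 a) fu; have hg := ler_wpM2l (normr_ge0 a) gv.
exists (a *: (u + v)); split.
  apply: le_trans (cscaleP _ _ _) _.
  have := ler_wpM2l (normr_ge0 a) (cDP f g u v); rewrite mulrDr; lra.
rewrite scalerDr; apply: le_trans (cDP _ _ _ _) _.
by have := cscaleP a f u; have := cscaleP a g v; lra.
Qed.

Lemma cscaleDl f : {morph cscale^~ f : a b / a + b}.
Proof.
move=> a b; apply: completion_eq => e e0.
have [|d d0 ad] := @scale_bound R (`|a| + `|b|) e; first lra.
rewrite ger0_norm ?addr_ge0// in ad.
have [u fu] := capprox f d0.
have hf := ler_wpM2l (addr_ge0 (normr_ge0 a) (normr_ge0 b)) fu.
exists ((a + b) *: u); split.
  apply: le_trans (cscaleP _ _ _) _; apply: le_trans ad; apply: le_trans hf.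
  by rewrite ler_wpM2r ?cdist_ge0 ?ler_normD.
rewrite scalerDl; apply: le_trans (cDP _ _ _ _) _.
have := cscaleP a f u; have := cscaleP b f u; rewrite mulrDl in hf; lra.
Qed.

HB.instance Definition _ := GRing.Zmodule_isLmodule.Build R B
  cscaleA cscale1 cscaleDr cscaleDl.

Lemma cZP a f u : (a *: f) (a *: u) <= `|a| * f u.
Proof. exact: cscaleP. Qed.

Lemma cdistC f u : `|f 0 - p u| <= f u.
Proof.
have := kat_le (cdistP f) 0 u; have := kat_ge (cdistP f) u 0.
rewrite sub0r (snN hp) subr0 => h1 h2.
by rewrite ler_norml; apply/andP; split; lra.
Qed.

Lemma cnormD f g : (f + g) 0 <= f 0 + g 0.
Proof.
apply/ler_addgt0Pr => e e0; have e40 : 0 < e / 4 by lra.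
have [u fu] := capprox f e40; have [v gv] := capprox g e40.
have := cDP f g u v; have := cdistC (f + g) (u + v).
have := cdistC f u; have := cdistC g v; have := snD hp u v.
by rewrite !ler_norml => ? /andP[? ?] /andP[? ?] /andP[? ?] ?; lra.
Qed.

Lemma cnormZ a f : (a *: f) 0 = `|a| * f 0.
Proof.
apply/eqP; rewrite -subr_eq0 -normr_le0; apply/ler_addgt0Pr => e e0.
have [|d d0 ad] := @scale_bound R a (e / 2); first lra.
have [u fu] := capprox f d0.
have hf := ler_wpM2l (normr_ge0 a) fu.
have := cZP a f u; have := cdistC (a *: f) (a *: u).
have := ler_wpM2l (normr_ge0 a) (cdistC f u).
rewrite -[X in X * `|_| <= _]normr_id -normrM mulrBr (snZ hp).
by rewrite !ler_norml => /andP[? ?] /andP[? ?] ?; apply/andP; split; lra.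
Qed.

Lemma cnorm0_eq0 f : f 0 = 0 -> f = 0.
Proof.
move=> f0; apply: completion_eq => e e0; exists 0.
by rewrite f0 ltW// (cembedE 0) ltW.
Qed.

HB.instance Definition _ :=
  Lmodule_isNormed.Build R B cnormD cnormZ cnorm0_eq0.

Lemma cnormE f : `|f| = f 0. Proof. by []. Qed.

Lemma cembed_linear : linear cembed.
Proof.
move=> a x y; apply: completion_eq => e e0; exists (a *: x + y).
rewrite cembedE ltW//; split=> //; apply: le_trans (cDP _ _ _ _) _.
by have := cZP a (cembed x) x; rewrite !cembedE; lra.
Qed.

Lemma norm_cembed x : `|cembed x| = p x.
Proof. by rewrite cnormE /= sub0r (snN hp). Qed.

Lemma cdist_norm f u : `|f - cembed u| = f u.
Proof.
rewrite cnormE; apply/eqP; rewrite -subr_eq0 -normr_le0.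
apply/ler_addgt0Pr => e e0; have e40 : 0 < e / 4 by lra.
have [v fv] := capprox f e40.
have := cDP f (- cembed u) v (- u).
have -> : - cembed u = cembed (- u) by rewrite (linN cembed_linear).
rewrite cembedE; have := cdistC (f + cembed (- u)) (v - u).
have := kat_le (cdistP f) u v; have := kat_ge (cdistP f) v u.
by rewrite (snC hp u) !ler_norml => ? ? /andP[? ?] ?; apply/andP; split; lra.
Qed.

Lemma completion_dense f e : 0 < e -> exists v, `|f - cembed v| <= e.
Proof. by move=> /(capprox f)[v fv]; exists v; rewrite cdist_norm. Qed.

(** A Cauchy filter is itself a coherent family of approximations. *)
Lemma completion_complete (F : set_system B) :
  ProperFilter F -> cauchy F -> cvg F.
Proof.
move=> FF /cauchyP Fc.
pose A u e := forall d, 0 < d -> F [set f | `|f - cembed u| <= e + d].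
have [||f hf] := @completion_of_approx A.
- move=> e e0; have [|f Ff] := Fc (e / 2); first lra.
  have [|u fu] := @completion_dense f (e / 2); first lra.
  exists u => d d0; apply: filterS Ff => g; rewrite -ball_normE /= => fg.
  have := ler_distD f g (cembed u); rewrite (distrC g f); lra.
- move=> u e u' e' Au Au'; apply/ler_addgt0Pr => d d0.
  have d20 : 0 < d / 2 by lra.
  have [g [/= gu gu']] := filter_ex (filterI (Au _ d20) (Au' _ d20)).
  rewrite -norm_cembed (linB cembed_linear).
  by have := ler_distD g (cembed u) (cembed u'); rewrite (distrC _ g); lra.
apply/cvg_ex; exists f; apply/cvgrPdist_le => /= e e0.
have [|g Fg] := Fc (e / 4); first lra.
have [|u gu] := @completion_dense g (e / 4); first lra.
have Au : A u (e / 2).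
  move=> d d0; apply: filterS Fg => h; rewrite -ball_normE /= => gh.
  by have := ler_distD g h (cembed u); rewrite (distrC h g); lra.
have fu := hf _ _ Au; rewrite -cdist_norm in fu.
apply: filterS Fg => h; rewrite -ball_normE /= => gh.
have := ler_distD (cembed u) f h; have := ler_distD g (cembed u) h.
by rewrite (distrC _ g); lra.
Qed.

HB.instance Definition _ := Uniform_isComplete.Build B completion_complete.

End Completion.

(** * Extension of isometries, finite-dimensional spaces *)

Lemma cauchy_limit (R : realType) (X : completeNormedModType R)
    (u : nat -> X) :
  (forall e, 0 < e -> exists N, forall k l, (N <= k)%N -> (N <= l)%N ->
     `|u k - u l| <= e) ->
  exists x, forall e, 0 < e -> exists N, forall k, (N <= k)%N ->
     `|u k - x| <= e.
Proof.
move=> hu.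
have uC : cauchy (u @ \oo).
  apply: cauchy_exP => e e0; have [|N hN] := hu (e / 2); first lra.
  exists (u N); rewrite -ball_normE; exists N => // k /= Nk.
  by have := hN _ _ (leqnn N) Nk; lra.
have /cvg_ex/= [x /cvgrPdist_le hx] : cvg (u @ \oo) by exact: cauchy_cvg.
exists x => e /hx[N _ hN]; exists N => k Nk.
by rewrite distrC; apply: hN.
Qed.

Lemma inv_small (R : realType) (e : R) : 0 < e ->
  exists N, forall n, (N <= n)%N -> n.+1%:R^-1 <= e.
Proof.
move=> e0; have [N] := ltr_add_invr e0.
rewrite add0r => hN; exists N => n Nn; apply: le_trans (ltW hN).
by rewrite lef_pV2 ?posrE// ler_nat.
Qed.

Lemma norm_eq0_eps (R : realType) (X : normedModType R) (x : X) :
  (forall e, 0 < e -> `|x| <= e) -> x = 0.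
Proof.
move=> hx; apply/eqP; rewrite -normr_le0; apply/ler_addgt0Pr => e /hx.
by rewrite add0r.
Qed.

Lemma embP (R : realType) (F F' : completeNormedModType R)
  (i : embedding F F') : linear i.
Proof. by move=> c x y; rewrite linearP. Qed.

(** The graph of the extension is the closure of the graph of the isometry. *)
Section Extension.
Variables (R : realType) (V : lmodType R) (G X : completeNormedModType R).
Variables (i : V -> G) (g : V -> X).
Hypotheses (hi : linear i) (hg : linear g).
Hypothesis ig : forall v, `|g v| = `|i v|.
Hypothesis idense : forall x e, 0 < e -> exists v, `|x - i v| <= e.

Let graph x y := forall e, 0 < e ->
  exists v, `|x - i v| <= e /\ `|y - g v| <= e.

Let graph_embed v : graph (i v) (g v).
Proof. by move=> e e0; exists v; rewrite !subrr !normr0 ltW. Qed.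

Let graph_lin a x y x' y' : graph x y -> graph x' y' ->
  graph (a *: x + x') (a *: y + y').
Proof.
move=> xy xy' e e0; have e20 : 0 < e / 2 by lra.
have [b b0 ab] := scale_bound a e20.
have [v [xv yv]] := xy _ b0; have [v' [xv' yv']] := xy' _ e20.
have lip (Z : normedModType R) (z z' w w' : Z) :
    `|z - w| <= b -> `|z' - w'| <= e / 2 ->
    `|a *: z + z' - (a *: w + w')| <= e.
  move=> zw zw'; rewrite opprD addrACA -scalerBr.
  apply: le_trans (ler_normD _ _) _; rewrite normrZ.
  by have := le_trans (ler_wpM2l (normr_ge0 a) zw) ab; lra.
exists (a *: v + v'); rewrite (linD hi) (linD hg) (linZ hi) (linZ hg).
by split; apply: lip.
Qed.

Let graph_norm x y : graph x y -> `|y| = `|x|.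
Proof.
move=> xy; apply/eqP; rewrite -subr_eq0 -normr_le0; apply/ler_addgt0Pr => e e0.
have [|v [xv yv]] := xy (e / 2); first lra.
have := ler_dist_dist x (i v); have := ler_dist_dist y (g v); rewrite ig.
by rewrite !ler_norml => /andP[? ?] /andP[? ?]; apply/andP; split; lra.
Qed.

Let graph_uniq x y y' : graph x y -> graph x y' -> y = y'.
Proof.
move=> xy xy'; have /graph_norm := graph_lin (-1) xy xy'.
rewrite !scaleN1r addNr normr0 => /eqP.
by rewrite normr_eq0 addrC subr_eq0 => /eqP.
Qed.

Let graph_ex x : exists y, graph x y.
Proof.
pose d n : R := n.+1%:R^-1.
have d0 n : 0 < d n by rewrite invr_gt0.
have /choice[v hv] : forall n, exists v, `|x - i v| <= d n.
  by move=> n; apply: idense.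
have dsmall e : 0 < e -> exists N, forall n, (N <= n)%N -> d n <= e
  by exact: inv_small.
have [|y hy] := @cauchy_limit R X (fun n => g (v n)).
  move=> e e0; have [|N hN] := dsmall (e / 2); first lra.
  exists N => k l /hN hk /hN hl; rewrite -(linB hg) ig (linB hi).
  have := ler_distD x (i (v k)) (i (v l)); have := hv k; have := hv l.
  by rewrite (distrC _ x); lra.
exists y => e e0; have [N hN] := dsmall _ e0; have [M hM] := hy _ e0.
exists (v (maxn N M)); split.
  by apply: le_trans (hv _) _; apply: hN; rewrite leq_maxl.
by rewrite distrC; apply: hM; rewrite leq_maxr.
Qed.

Lemma extend_isometry : exists f : embedding G X, forall v, f (i v) = g v.
Proof.
have [f hf] := choice graph_ex.
have flin : linear f.
  by move=> a x y; apply: graph_uniq (hf _) _; apply: graph_lin.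
have [f' ff'] := lin_bundle flin.
have f'iso x : `|f' x| = `|x| by rewrite ff'; apply: graph_norm.
by exists (Embedding f'iso) => v /=; rewrite ff'; apply: graph_uniq (hf _) _.
Qed.

End Extension.

Section RowVectors.
Variable R : realType.

Definition l1 n (v : 'rV[R]_n) : R := \sum_(i < n) `|v 0 i|.

Lemma seminorm_l1 n : seminorm (@l1 n).
Proof.
split=> [x y|a x]; rewrite /l1.
  by rewrite -big_split; apply: ler_sum => i _; rewrite mxE ler_normD.
by rewrite mulr_sumr; apply: eq_bigr => i _; rewrite mxE normrM.
Qed.

Lemma l1_row_mx m n (u : 'rV[R]_m) (v : 'rV[R]_n) :
  l1 (row_mx u v) = l1 u + l1 v.
Proof.
rewrite /l1 big_split_ord /=; congr (_ + _); apply: eq_bigr => i _.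
  by rewrite row_mxEl.
by rewrite row_mxEr.
Qed.

Lemma lin_rowE (X : lmodType R) n (L : 'rV[R]_n -> X) (hL : linear L) v :
  L v = \sum_(i < n) v 0 i *: L (delta_mx 0 i).
Proof.
have [L' LL'] := lin_bundle hL; rewrite -LL' {1}(row_sum_delta v) linear_sum.
by apply: eq_bigr => i _; rewrite linearZZ LL'.
Qed.

Lemma linear_comb (X : lmodType R) n (b : 'I_n -> X) :
  linear (fun v : 'rV[R]_n => \sum_(i < n) v 0 i *: b i).
Proof.
move=> a u v; rewrite scaler_sumr -big_split; apply: eq_bigr => i _.
by rewrite !mxE scalerDl scalerA.
Qed.

Lemma sn_row_le (n : nat) (p : 'rV[R]_n -> R) (C : R) : seminorm p ->
  (forall i, p (delta_mx 0 i) <= C) -> forall v, p v <= C * l1 v.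
Proof.
move=> hp hC v; rewrite {1}(row_sum_delta v).
apply: le_trans (sn_sum hp _ _) _; rewrite mulr_sumr; apply: ler_sum => i _.
by rewrite (snZ hp) mulrC ler_wpM2r.
Qed.

Lemma sn_row_bound (n : nat) (p : 'rV[R]_n -> R) : seminorm p ->
  exists2 C, 0 < C & forall v, p v <= C * l1 v.
Proof.
move=> hp; pose C := \sum_(i < n) p (delta_mx 0 i).
have C0 : 0 <= C by apply: sumr_ge0 => i _; apply: sn_ge0.
exists (C + 1); first lra.
apply: sn_row_le => // i; rewrite /C (bigD1 i)//=.
have : 0 <= \sum_(j < n | j != i) p (delta_mx 0 j).
  by apply: sumr_ge0 => j _; apply: sn_ge0.
by lra.
Qed.

Lemma row1E n (v : 'rV[R]_(1 + n)) :
  v = lsubmx v 0 0 *: row_mx 1%:M 0 + row_mx 0 (rsubmx v).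
Proof.
rewrite scale_row_mx add_row_mx scaler0 add0r addr0 -{1}[v]hsubmxK.
congr row_mx; apply/rowP => i; rewrite !ord1 !mxE eqxx mulr1.
by [].
Qed.

Lemma linear_row0 m n : linear (fun v : 'rV[R]_n => row_mx (0 : 'rV[R]_m) v).
Proof.
by move=> a u v; rewrite scale_row_mx add_row_mx scaler0 addr0.
Qed.

Lemma coeff_le (V : lmodType R) (X : normedModType R) (L : V -> X) b d :
  linear L -> (forall w, ~ `|b - L w| <= d) ->
  forall t w, `|t| * d <= `|t *: b + L w|.
Proof.
move=> hL hd t w; have [->|t0] := eqVneq t 0; first by rewrite normr0 mul0r.
have := hd (- t^-1 *: w) => /negP; rewrite -ltNge => /ltW hw.
have -> : t *: b + L w = t *: (b - L (- t^-1 *: w)).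
  by rewrite scalerBr -(linZ hL) scalerA mulrN divff// scaleN1r (linN hL) opprK.
by rewrite normrZ ler_wpM2l.
Qed.

(** Induction on the dimension: when the last basis vector [b] is not in the
    closure of the span of the others, its distance to this span is positive,
    hence the coefficient of [b] is a Lipschitz function on the whole span. *)
Lemma closed_range (X : normedModType R) n (L : 'rV[R]_n -> X) (x : X) :
  linear L -> (forall e, 0 < e -> exists v, `|x - L v| <= e) ->
  exists v, x = L v.
Proof.
elim: n L x => [|n IH] L x hL hx.
  exists 0; apply/eqP; rewrite -subr_eq0; apply/eqP; apply: norm_eq0_eps => e.
  by move=> /hx[v]; rewrite (_ : v = 0)//; apply/rowP => -[].
have {}hx e : 0 < e -> exists v : 'rV[R]_(1 + n), `|x - L v| <= e := hx e.
pose L' (w : 'rV[R]_n) := L (row_mx (0 : 'rV[R]_1) w).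
have hL' : linear L' by apply: linear_compose => //; apply: linear_row0.
pose b := L (row_mx (1%:M : 'rV[R]_1) (0 : 'rV[R]_n)).
have LE (v : 'rV[R]_(1 + n)) : L v = lsubmx v 0 0 *: b + L' (rsubmx v).
  by rewrite {1}[v]row1E (linD hL) (linZ hL).
have inL t w : exists v, t *: b + L' w = L v.
  exists (t *: row_mx 1%:M 0 + row_mx 0 w).
  by rewrite (linD hL) (linZ hL).
have [hb|/existsNP[d /not_implyP[d0 /forallNP hd]]] :=
  pselect (forall e, 0 < e -> exists w, `|b - L' w| <= e).
  have [w0 bw0] := IH _ _ hL' hb.
  have [|w ->] := IH L' x hL'; last first.
    by have [v] := inL 0 w; rewrite scale0r add0r; exists v.
  move=> e /hx[v]; rewrite LE bw0 -(linZ hL') -(linD hL') => hv.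
  by exists (lsubmx v 0 0 *: w0 + rsubmx v).
have bdist := coeff_le hL' hd.
pose r k : R := k.+1%:R^-1.
have r0 k : 0 < r k by rewrite invr_gt0.
have rsmall e : 0 < e -> exists N, forall n, (N <= n)%N -> r n <= e
  by exact: inv_small.
have /choice[v hv] : forall k, exists v : 'rV[R]_(1 + n), `|x - L v| <= r k.
  by move=> k; apply: hx.
pose t k := lsubmx (v k) 0 0.
have [|s hs] := @cauchy_limit R R t.
  move=> e e0; have [|N hN] := rsmall (e * d / 2).
    by rewrite divr_gt0 ?mulr_gt0.
  exists N => k l /hN hk /hN hl.
  rewrite -(ler_pM2r d0).
  have := bdist (t k - t l) (rsubmx (v k) - rsubmx (v l)).
  rewrite scalerBl (linB hL') addrACA -opprD -!LE.
  have := ler_distD x (L (v k)) (L (v l)); have := hv k; have := hv l.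
  by rewrite (distrC _ x); lra.
have [|w hw] := IH L' (x - s *: b) hL'; last first.
  by have [u hu] := inL s w; exists u; rewrite -hu -hw addrC subrK.
move=> e e0; have [|N hN] := rsmall (e / 2); first lra.
have b0 : 0 < `|b| + 1 by have := normr_ge0 b; lra.
have [|M hM] := hs (e / 2 / (`|b| + 1)); first by rewrite !divr_gt0.
pose k := maxn N M.
exists (rsubmx (v k)).
have -> : x - s *: b - L' (rsubmx (v k)) =
    (x - L (v k)) + (t k - s) *: b.
  by rewrite LE scalerBl (addrC _ (L' _)) opprD (addrA x) subrKA addrAC.
apply: le_trans (ler_normD _ _) _; rewrite normrZ.
have := hv k; have := hN k (leq_maxl _ _).
have : `|t k - s| * `|b| <= e / 2.
  apply: le_trans (ler_wpM2r (normr_ge0 b) (hM k (leq_maxr _ _))) _.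
  by rewrite mulrAC ler_pdivrMr// ler_wpM2l; lra.
by lra.
Qed.

(** By the same induction, using that the span of the other basis vectors, being
    closed, is at positive distance from [b]. *)
Lemma coord_bound (X : normedModType R) n (L : 'rV[R]_n -> X) :
  linear L -> (forall v, L v = 0 -> v = 0) ->
  exists2 C, 0 < C & forall v, l1 v <= C * `|L v|.
Proof.
elim: n L => [|n IH] L hL Linj.
  by exists 1 => // v; rewrite /l1 big_ord0 mul1r.
have {}Linj (v : 'rV[R]_(1 + n)) : L v = 0 -> v = 0 := Linj v.
pose L' (w : 'rV[R]_n) := L (row_mx (0 : 'rV[R]_1) w).
have hL' : linear L' by apply: linear_compose => //; apply: linear_row0.
have [|C C0 hC] := IH L' hL'.
  move=> v /Linj; rewrite -[RHS](@row_mx0 _ 1 1 n) => /eq_row_mx[_]//.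
pose b := L (row_mx (1%:M : 'rV[R]_1) (0 : 'rV[R]_n)).
have LE (v : 'rV[R]_(1 + n)) : L v = lsubmx v 0 0 *: b + L' (rsubmx v).
  by rewrite {1}[v]row1E (linD hL) (linZ hL).
have [hb|/existsNP[d /not_implyP[d0 /forallNP hd]]] :=
  pselect (forall e, 0 < e -> exists w, `|b - L' w| <= e).
  have [w bw] := closed_range hL' hb.
  have /Linj : L (row_mx (1%:M : 'rV[R]_1) (- w)) = 0.
    by rewrite LE row_mxKl row_mxKr mxE eqxx scale1r (linN hL') -bw subrr.
  rewrite -[RHS](@row_mx0 _ 1 1 n) => /eq_row_mx[/matrixP/(_ 0 0)].
  by rewrite !mxE eqxx => /eqP; rewrite oner_eq0.
have bdist := coeff_le hL' hd.
exists (d^-1 + C * (1 + d^-1 * `|b|)).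
  have dV : 0 < d^-1 by rewrite invr_gt0.
  by rewrite addr_gt0// mulr_gt0// ltr_pwDl// mulr_ge0// ltW.
move=> v; pose v1 : 'rV[R]_(1 + n) := v.
have -> : l1 v = `|lsubmx v1 0 0| + l1 (rsubmx v1).
  have -> : l1 v = l1 (row_mx (lsubmx v1) (rsubmx v1)) by rewrite hsubmxK.
  by rewrite l1_row_mx /l1 big_ord1.
have := hC (rsubmx v1); have := bdist (lsubmx v1 0 0) (rsubmx v1).
rewrite -LE -[L v1]/(L v) -ler_pdivlMr// mulrC => h1 h2.
have h3 : `|L' (rsubmx v1)| <= `|L v| + `|lsubmx v1 0 0| * `|b|.
  have -> : L' (rsubmx v1) = L v - lsubmx v1 0 0 *: b.
    by rewrite (LE v) addrC addKr.
  by apply: le_trans (ler_normB _ _) _; rewrite normrZ.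
have h4 := ler_wpM2l (ltW C0) h3.
have h5 := ler_wpM2l (ltW C0) (ler_wpM2r (normr_ge0 b) h1).
apply: le_trans (lerD h1 (le_trans h2 h4)) _.
rewrite mulrDl lerD2l -mulrA ler_wpM2l ?(ltW C0)// mulrDl mul1r lerD2l.
by rewrite mulrAC ler_wpM2r.
Qed.

End RowVectors.

Section FiniteDimension.
Variable R : realType.

Lemma completion_finite_dim (V : lmodType R) (p : V -> R) (hp : seminorm p)
    n (L : 'rV[R]_n -> V) :
  linear L -> (forall v, exists u, v = L u) ->
  (forall x : completion hp, exists v, x = cembed hp v) /\
  finite_dimensional (completion hp).
Proof.
move=> hL Lsurj; pose K u := cembed hp (L u).
have hK : linear K by apply: linear_compose (cembed_linear hp) hL.
have surj (x : completion hp) : exists u, x = K u.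
  apply: closed_range hK _ => e e0; have [v hv] := completion_dense x e0.
  by have [u vu] := Lsurj v; exists u; rewrite /K -vu.
split=> [x|]; first by have [u ->] := surj x; exists (L u).
exists n, (fun i => K (delta_mx 0 i)) => x; have [u ->] := surj x.
by exists (fun i => u 0 i); apply: lin_rowE.
Qed.

Lemma basis_extension (X : lmodType R) k (L : 'rV[R]_k -> X) (s : seq X) :
  linear L -> (forall u, L u = 0 -> u = 0) ->
  exists l (M : 'rV[R]_l -> X), [/\ linear M,
    forall u w, L u + M w = 0 -> u = 0 /\ w = 0 &
    forall x, x \in s -> exists u w, x = L u + M w].
Proof.
move=> hL Linj; elim: s => [|x s [l [M [hM LMinj LMs]]]].
  exists 0%N, (fun=> 0); split=> // [a u v|u w].
    by rewrite scaler0 addr0.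
  by rewrite addr0 => /Linj ->; split=> //; apply/rowP => -[].
have [[u [w xuw]]|xout] := pselect (exists u w, x = L u + M w).
  exists l, M; split=> // y; rewrite inE => /orP[/eqP->|/LMs//].
  by exists u, w.
pose M' (v : 'rV[R]_(1 + l)) := lsubmx v 0 0 *: x + M (rsubmx v).
exists (1 + l)%N, M'; split.
- move=> a u v; rewrite /M' [lsubmx _]linearP [rsubmx _]linearP hM !mxE.
  by rewrite scalerDl scalerDr -scalerA addrACA.
- move=> u w; rewrite /M' addrCA => h.
  have w0 : lsubmx w 0 0 = 0.
    apply/eqP/negPn/negP => w0; apply: xout.
    exists (- (lsubmx w 0 0)^-1 *: u), (- (lsubmx w 0 0)^-1 *: rsubmx w).
    apply: (scalerI w0); rewrite (linZ hL) (linZ hM) -scalerDr scalerA mulrN.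
    by rewrite divff// scaleN1r; apply/eqP; rewrite -addr_eq0 h.
  move: h; rewrite w0 scale0r add0r => /LMinj[-> rw0]; split=> //.
  rewrite -[w]hsubmxK rw0 (_ : lsubmx w = 0) ?row_mx0//.
  by apply/rowP => i; rewrite ord1 w0 mxE.
- move=> y; rewrite inE => /orP[/eqP->|/LMs[u [w ->]]].
    exists 0, (row_mx 1%:M 0).
    by rewrite /M' row_mxKl row_mxKr mxE eqxx scale1r (lin0 hL) (lin0 hM)
      add0r addr0.
  exists u, (row_mx 0 w).
  by rewrite /M' row_mxKl row_mxKr mxE scale0r add0r.
Qed.

Lemma finite_dim_complement (X : completeNormedModType R) k
    (L : 'rV[R]_k -> X) :
  finite_dimensional X -> linear L -> (forall u, L u = 0 -> u = 0) ->
  exists l (M : 'rV[R]_l -> X), [/\ linear M,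
    forall u w, L u + M w = 0 -> u = 0 /\ w = 0 &
    forall x, exists u w, x = L u + M w].
Proof.
move=> [n [b bX]] hL Linj.
have [l [M [hM LMinj LMb]]] :=
  basis_extension [seq b i | i <- enum 'I_n] hL Linj.
exists l, M; split=> // x; have [c ->] := bX x.
elim/big_ind: _ => [|y z [u [w ->]] [u' [w' ->]]|i _].
- by exists 0, 0; rewrite (lin0 hL) (lin0 hM) addr0.
- by exists (u + u'), (w + w'); rewrite (linD hL) (linD hM) addrACA.
- have [|u [w ->]] := LMb (b i); first by rewrite map_f// mem_enum.
  by exists (c i *: u), (c i *: w); rewrite (linZ hL) (linZ hM) scalerDr.
Qed.

(** The defining property of a Gurarij space in terms of seminorms on formal
    combinations.  These may vanish on nonzero vectors, so that the tuples
    involved need not be independent: the finite-dimensional spaces to which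
    the definition is applied are the completions. *)
Lemma gurarij_realise (H : completeNormedModType R) m n (h : 'rV[R]_m -> H)
    (tau : 'rV[R]_m * 'rV[R]_n -> R) (e : R) :
  gurarij H -> linear h -> seminorm tau -> (forall u, tau (u, 0) = `|h u|) ->
  0 < e -> exists2 c : 'rV[R]_n -> H, linear c &
  forall u w, `| `|h u + c w| - tau (u, w)| <= e * tau (u, w).
Proof.
move=> Hgur hh htau tauh e0.
have hp : seminorm (fun u => `|h u|).
  by apply: seminorm_comp => //; apply: seminorm_norm.
pose E1 : completeNormedModType R := completion hp.
pose F1 : completeNormedModType R := completion htau.
have [cE1 fE1] := completion_finite_dim hp
  (@linear_id R 'rV[R]_m) (fun v => ex_intro _ v erefl).
have [|w|cF1 fF1] := @completion_finite_dim _ _ htau (m + n)%N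
    (fun v => (lsubmx v, rsubmx v)).
- by move=> a u v; rewrite !linearP.
- by exists (row_mx w.1 w.2); rewrite row_mxKl row_mxKr; case: w.
have hi : linear (cembed hp) := cembed_linear hp.
have hiF : linear (fun u : 'rV[R]_m => cembed htau (u, 0)).
  by apply: linear_compose (cembed_linear htau) (linear_pair _ _);
    [exact: linear_id|exact: linear_0].
have hcF : linear (fun w : 'rV[R]_n => cembed htau (0, w)).
  by apply: linear_compose (cembed_linear htau) (linear_pair _ _);
    [exact: linear_0|exact: linear_id].
have [|j hj] := extend_isometry (i := cembed hp : _ -> E1)
    (g := (fun u => cembed htau (u, 0)) : _ -> F1) hi hiF _
    (@completion_dense _ _ _ _).
  by move=> u; rewrite !norm_cembed tauh.
have [|phi hphi] := extend_isometry (i := cembed hp : _ -> E1)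
    (g := h) hi hh _ (@completion_dense _ _ _ _).
  by move=> u; rewrite norm_cembed.
have [psi [psij psin]] := Hgur e e0 E1 F1 j phi fE1 fF1.
exists (fun w => psi (cembed htau (0, w))).
  by move=> a u v; rewrite hcF linearP.
move=> u w; have -> : h u + psi (cembed htau (0, w)) = psi (cembed htau (u, w)).
  rewrite -hphi -psij hj -linearD -(linD (cembed_linear htau)).
  by rewrite -[_ + _]/(u + 0, 0 + w) addr0 add0r.
have := psin (cembed htau (u, w)); rewrite norm_cembed => /andP[h1 h2].
by rewrite ler_norml; apply/andP; split; lra.
Qed.

End FiniteDimension.

(** * Topology and distance on types *)

Section Types.
Variables (R : realType) (E : completeNormedModType R) (n : nat).
Implicit Types (xi zeta : ntype E n) (x : formal_ext E n).

Lemma ntype_eq xi zeta : (forall x, xi x = zeta x) -> xi = zeta.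
Proof.
case: xi zeta => [f hf1 hf2] [g hg1 hg2] /= /funext fg.
by move: hf1 hf2; rewrite fg => *; congr NType; exact: Prop_irrelevance.
Qed.

Lemma nbhs_ntype xi (W : set (ntype E n)) : nbhs xi W ->
  exists (s : seq (formal_ext E n)) (e : R), 0 < e /\
    forall zeta, (forall x, x \in s -> `|zeta x - xi x| < e) -> W zeta.
Proof.
pose D := [set se : seq (formal_ext E n) * R | 0 < se.2].
pose B (se : seq (formal_ext E n) * R) :=
  [set zeta : ntype E n | forall x, x \in se.1 -> `|zeta x - xi x| < se.2].
have FF : Filter (filter_from D B).
  apply: filter_from_filter; first by exists ([::], 1); exact: ltr01.
  move=> [s e] [s' e'] /= e0 e'0; exists (s ++ s', Num.min e e').
    by rewrite /D /= lt_min e0.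
  move=> zeta /= h; split=> x xs; have := h x; rewrite mem_cat xs ?orbT;
    by move=> /(_ isT); rewrite lt_min => /andP[].
suff : filter_from D B --> xi.
  by move=> h /h [[s e] /= e0 BW]; exists s, e; split.
apply/cvg_sup => x A /=.
rewrite (@nbhsE (initial_topology (fun xi : ntype E n => xi x : R))).
move=> [_ [[C Cop <-] Cxi sCA]].
have /nbhs_ballP[e e0 /= eC] : nbhs (xi x) C by apply: open_nbhs_nbhs.
exists ([:: x], e) => // zeta /= /(_ x (mem_head _ _)) h; apply: sCA.
by apply: eC; rewrite -ball_normE /= distrC.
Qed.

Lemma ntype_nbhs xi (s : seq (formal_ext E n)) (e : R) : 0 < e ->
  nbhs xi [set zeta : ntype E n | forall x, x \in s -> `|zeta x - xi x| < e].
Proof.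
move=> e0; elim: s => [|x s IH].
  by apply: filterS filterT => zeta _ x; rewrite in_nil.
have hx : nbhs xi [set zeta : ntype E n | `|zeta x - xi x| < e].
  have /cvg_sup/(_ x) h : nbhs xi --> xi by exact: cvg_id.
  apply: h.
  rewrite /= (@nbhsE (initial_topology (fun xi : ntype E n => xi x : R))).
  exists [set zeta : ntype E n | `|zeta x - xi x| < e] => //; split.
    exists (ball (xi x) e); first exact: ball_open.
    by apply/seteqP; split=> zeta; rewrite /= -ball_normE /= distrC.
  by rewrite /= subrr normr0.
have := @filterI _ (nbhs xi) (nbhs_filter xi) _ _ hx IH.
apply: (@filterS _ (nbhs xi) (nbhs_filter xi)) => zeta [h1 h2] y.
by rewrite inE => /orP[/eqP ->//|/h2].
Qed.

Lemma type_dist_lt xi zeta r : (type_dist xi zeta < r%:E)%E ->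
  forall x, `|xi x - zeta x| <= r * l1 x.2.
Proof.
move=> /ereal_inf_lt[_ [F [j [a [b [-> -> ->]]]]]] /=.
rewrite lte_fin => /ltW ab x; apply: le_trans (ler_dist_dist _ _) _.
rewrite /eval_tuple opprD addrACA subrr add0r -sumrB.
apply: le_trans (ler_norm_sum _ _ _) _; rewrite /l1 mulr_sumr.
apply: ler_sum => i _; rewrite -scalerBr normrZ mulrC ler_wpM2r//.
apply: le_trans ab; rewrite /sup_dist.
exact: (le_bigmax (0 : R) (fun i => `|a i - b i|)).
Qed.

Lemma l1_delta (i : 'I_n) : l1 (delta_mx 0 i : 'rV[R]_n) = 1.
Proof.
rewrite /l1 (bigD1 i)//= big1 ?addr0 ?mxE ?eqxx ?normr1// => k /negPf ki.
by rewrite mxE ki andbF normr0.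
Qed.

(** Amalgamating realisations of [xi] and [zeta] over [E] and charging [r] for
    replacing a variable of the first tuple by that of the second yields a
    seminorm which restricts to [xi] and to [zeta] exactly when the two differ
    by at most [r] times the l1 norm of the coefficients. *)
Lemma type_dist_le xi zeta r : 0 <= r ->
  (forall x, `|xi x - zeta x| <= r * l1 x.2) -> (type_dist xi zeta <= r%:E)%E.
Proof.
move=> r0 xz.
have hxi := ntype_seminorm xi; have hze := ntype_seminorm zeta.
have hl1 := @seminorm_l1 R n.
pose X := formal_ext E n; pose Y := ((X * X) * 'rV[R]_n)%type.
pose Q (y : Y) := xi y.1.1 + zeta y.1.2 + r * l1 y.2.
pose T (z : X) : Y := ((- z, z), z.2).
have hQ : seminorm Q.
  apply: seminorm_add; first apply: seminorm_add.
  - exact: (seminorm_comp (T := fun y : Y => y.1.1)).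
  - exact: (seminorm_comp (T := fun y : Y => y.1.2)).
  - exact: (seminorm_scale r0 (seminorm_comp (T := fun y : Y => y.2) hl1 _)).
have hT : linear T.
  apply: linear_pair; last exact: linear_snd.
  by apply: linear_pair => //; apply: linear_opp.
have hP0 := seminorm_qsn hQ hT.
have hemb : linear (fun v : X * X => (v, 0 : 'rV[R]_n)).
  by apply: linear_pair => //; apply: linear_0.
have hP := seminorm_comp hP0 hemb.
pose F : completeNormedModType R := completion hP.
pose c : X * X -> F := cembed hP.
have hc : linear c := cembed_linear hP.
have c1 x : `|c (x, 0)| = xi x.
  rewrite norm_cembed; apply/eqP; rewrite eq_le; apply/andP; split.
    apply: le_trans (qsn_le0 hQ hT _) _.
    by rewrite /Q /= (sn0 hze) (sn0 hl1) mulr0 !addr0.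
  apply: qsn_ge => z; rewrite /Q /= !add0r.
  have := snDB hxi (x - z) z; have := snD hxi (x - z) z; rewrite subrK.
  by have := xz z; rewrite ler_norml => /andP[? ?]; lra.
have c2 x : `|c (0, x)| = zeta x.
  rewrite norm_cembed; apply/eqP; rewrite eq_le; apply/andP; split.
    apply: le_trans (qsn_le0 hQ hT _) _.
    by rewrite /Q /= (sn0 hxi) (sn0 hl1) mulr0 add0r addr0.
  apply: qsn_ge => z; rewrite /Q /= !add0r (snN hxi).
  have := snB hze (x + z) z; rewrite addrK.
  by have := xz z; rewrite ler_norml => /andP[? ?]; lra.
have c12 x : `|c (x, 0) - c (0, x)| <= r * l1 x.2.
  rewrite -(linB hc) norm_cembed.
  apply: le_trans (qsn_le T hQ ((x, 0) - (0, x), 0) x) _.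
  rewrite /Q /= subr0 sub0r subrr addNr (sn0 hxi) (sn0 hze) !add0r.
  by [].
pose jf (b : E) : F := c ((b, 0), 0).
have hj : linear jf.
  exact: (linear_compose hc (linear_pair
    (linear_pair (@linear_id R E) (@linear_0 R E 'rV[R]_n)) (@linear_0 R E X))).
have [j jE] := lin_bundle hj.
have jiso b : `|j b| = `|b| by rewrite jE /jf c1 ntype_extends.
have jE2 b : j b = c (0, (b, 0)).
  apply/eqP; rewrite jE -subr_eq0 -normr_le0.
  by apply: le_trans (c12 _) _; rewrite /= (sn0 hl1) mulr0.
pose a (i : 'I_n) : F := c ((0, delta_mx 0 i), 0).
pose b (i : 'I_n) : F := c (0, (0, delta_mx 0 i)).
apply: ge_ereal_inf; exists (sup_dist a b)%:E.
  exists F, (Embedding jiso), a, b; split=> //; apply: ntype_eq => -[e l].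
    rewrite -c1 /= /eval_tuple /= jE.
    rewrite (_ : \sum_(i < n) _ = c ((0, l), 0)).
      rewrite -(linD hc) -[_ + _ in RHS]/((e + 0, 0 + l), 0 + 0).
      by rewrite !addr0 add0r.
    rewrite -(lin_rowE (L := fun l => c ((0, l), 0)))//.
    exact: (linear_compose hc (linear_pair
      (linear_pair (@linear_0 R 'rV[R]_n E) (@linear_id R 'rV[R]_n))
      (@linear_0 R 'rV[R]_n X))).
  rewrite -c2 /= /eval_tuple /= jE2.
  rewrite (_ : \sum_(i < n) _ = c (0, (0, l))).
    by rewrite -(linD hc) -[_ + _ in RHS]/(0 + 0, (e + 0, 0 + l)) !addr0 add0r.
  rewrite -(lin_rowE (L := fun l => c (0, (0, l))))//.
  exact: (linear_compose hc (linear_pair (@linear_0 R 'rV[R]_n X)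
    (linear_pair (@linear_0 R 'rV[R]_n E) (@linear_id R 'rV[R]_n)))).
rewrite lee_fin /sup_dist; apply: bigmax_le => // i _.
by apply: le_trans (c12 _) _; rewrite /= l1_delta mulr1.
Qed.

End Types.

(** * Formal combinations of a sequence of vectors *)

Section Combinations.
Variable R : realType.
Implicit Types f g : {poly R}.

Definition comb (X : lmodType R) (a : nat -> X) (f : {poly R}) : X :=
  \sum_(i < size f) f`_i *: a i.

Definition l1p (f : {poly R}) : R := \sum_(i < size f) `|f`_i|.

Lemma comb_widen (X : lmodType R) (a : nat -> X) f m :
  (size f <= m)%N -> comb a f = \sum_(i < m) f`_i *: a i.
Proof.
move=> fm; rewrite /comb (big_ord_widen _ (fun i => f`_i *: a i) fm).
rewrite big_mkcond; apply: eq_bigr => i _; case: ifP => // /negbT.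
by rewrite -leqNgt => /(nth_default 0) ->; rewrite scale0r.
Qed.

Lemma l1p_widen f m : (size f <= m)%N -> l1p f = \sum_(i < m) `|f`_i|.
Proof.
move=> fm; rewrite /l1p (big_ord_widen _ (fun i => `|f`_i|) fm).
rewrite big_mkcond; apply: eq_bigr => i _; case: ifP => // /negbT.
by rewrite -leqNgt => /(nth_default 0) ->; rewrite normr0.
Qed.

Lemma comb_linear (X : lmodType R) (a : nat -> X) : linear (comb a).
Proof.
move=> c f g; pose m := maxn (size (c *: f + g)%R) (maxn (size f) (size g)).
have mcfg : (size (c *: f + g)%R <= m)%N by rewrite leq_maxl.
have mf : (size f <= m)%N by rewrite /m !leq_max leqnn orbT.
have mg : (size g <= m)%N by rewrite /m !leq_max leqnn !orbT.
rewrite (comb_widen a mcfg) (comb_widen a mf) (comb_widen a mg).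
rewrite scaler_sumr -big_split; apply: eq_bigr => i _.
by rewrite coefD coefZ scalerDl scalerA.
Qed.

Lemma combXn (X : lmodType R) (a : nat -> X) i : comb a 'X^i = a i.
Proof.
rewrite (@comb_widen _ a _ i.+1) ?size_polyXn// big_ord_recr /=.
rewrite coefXn eqxx scale1r big1 ?add0r// => k _.
by rewrite coefXn (ltn_eqF (ltn_ord k)) scale0r.
Qed.

Lemma l1p_ge0 f : 0 <= l1p f.
Proof. by apply: sumr_ge0 => i _. Qed.

Lemma l1pD f g : l1p (f + g) <= l1p f + l1p g.
Proof.
pose m := maxn (size f) (size g).
have mf : (size f <= m)%N by rewrite leq_maxl.
have mg : (size g <= m)%N by rewrite leq_maxr.
have mfg : (size (f + g)%R <= m)%N by apply: size_polyD.
rewrite (l1p_widen mf) (l1p_widen mg) (l1p_widen mfg) -big_split.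
by apply: ler_sum => i _; rewrite coefD ler_normD.
Qed.

Lemma seminorm_l1p : seminorm l1p.
Proof.
split=> [f g|a f]; first exact: l1pD.
have afm : (size (a *: f)%R <= size f)%N by apply: size_scale_leq.
rewrite (l1p_widen afm) mulr_sumr; apply: eq_bigr => i _.
by rewrite coefZ normrM.
Qed.

Lemma l1pXn i : l1p ('X^i : {poly R}) = 1.
Proof.
rewrite (@l1p_widen _ i.+1) ?size_polyXn// big_ord_recr /=.
rewrite coefXn eqxx normr1 big1 ?add0r// => k _.
by rewrite coefXn (ltn_eqF (ltn_ord k)) normr0.
Qed.

Lemma comb_lip (X : normedModType R) (a b : nat -> X) f m e :
  (size f <= m)%N -> (forall i, (i < m)%N -> `|a i - b i| <= e) ->
  `|comb a f - comb b f| <= e * l1p f.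
Proof.
move=> fm ab; rewrite /comb -sumrB; apply: le_trans (ler_norm_sum _ _ _) _.
rewrite /l1p mulr_sumr; apply: ler_sum => i _.
rewrite -scalerBr normrZ mulrC ler_wpM2r//; apply: ab.
exact: leq_trans (ltn_ord i) fm.
Qed.

Lemma comb_rVpoly (X : lmodType R) (a : nat -> X) n (v : 'rV[R]_n) :
  comb a (rVpoly v) = \sum_(i < n) v 0 i *: a i.
Proof.
rewrite (comb_widen a (size_poly _ _)); apply: eq_bigr => i _.
by rewrite coef_rVpoly_ord.
Qed.

Lemma l1p_rVpoly n (v : 'rV[R]_n) : l1p (rVpoly v) = l1 v.
Proof.
rewrite (l1p_widen (size_poly _ _)); apply: eq_bigr => i _.
by rewrite coef_rVpoly_ord.
Qed.

Lemma rVpoly_linear n : linear (@rVpoly R n).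
Proof. by move=> a u v; rewrite linearP. Qed.

Lemma separable_seq (X : normedModType R) : separable X ->
  exists d : nat -> X, forall x e, 0 < e -> exists n, `|x - d n| <= e.
Proof.
move=> [A /countable_injP[g ginj] Adense].
pose D n x := A x /\ g x = n.
have /choice[d hd] : forall n, exists x, (exists y, D n y) -> D n x.
  move=> n; have [[x Dx]|nD] := pselect (exists y, D n y); first by exists x.
  by exists 0.
exists d => x e e0.
have [||y [xy Ay]] := Adense (ball x e).
- by exists x; apply: ballxx.
- exact: ball_open.
exists (g y); have [|Ad gd] := hd (g y); first by exists y.
rewrite (ginj (d (g y)) y) ?inE// ltW//.
by move: xy; rewrite -ball_normE.
Qed.

Lemma seq_separable (X : normedModType R) (d : nat -> X) :
  (forall x e, 0 < e -> exists n, `|x - d n| <= e) -> separable X.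
Proof.
move=> hd; exists (range d).
  exact: card_image_le.
move=> O [x Ox] Oop; have /nbhs_ballP[e /= e0 eO] : nbhs x O.
  exact: open_nbhs_nbhs.
have [|n hn] := hd x (e / 2); first lra.
exists (d n); split; last by exists n.
by apply: eO; rewrite -ball_normE /=; lra.
Qed.

End Combinations.

(** * Atomic implies prime *)

Section AtomicPrime.
Variables (R : realType) (E G H : completeNormedModType R).
Variables (j : embedding E G) (k : embedding E H).
Variables (a : nat -> G).

(** The first [m] terms of [b] have, over [E], nearly the type of those of
    [a]; by [type_dist_le] this says that these types are at distance at most
    [d]. *)
Definition close_types m (b : nat -> H) (d : R) :=
  forall (x : E) (f : {poly R}),
  (size f <= m)%N ->
  `| `|k x + comb b f| - `|j x + comb a f| | <= d * l1p f.

Hypothesis Hgur : gurarij H.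

(** Isolation reduces the approximation of the type of [a 0, ..., a (n-1)] to
    finitely many inequalities, which can be met in [H] by tuples close to a
    given one: it suffices to realise a finite-dimensional part of the amalgam
    of [G] and [H] over [E] in which [a i] is at distance [d] from [b i]. *)
Lemma close_types_step m n b d d' : (m <= n)%N ->
  isolated_type (tp j (fun i : 'I_n => a i)) ->
  0 < d -> 0 < d' -> close_types m b d ->
  exists b' : nat -> H, close_types n b' d' /\
    forall i, (i < m)%N -> `|b' i - b i| <= 2 * d.
Proof.
move=> mn iso d0 d'0 hb; set xi := tp j _ in iso.
have [|s [e [e0 hs]]] :=
  @nbhs_ntype _ _ _ xi [set zeta | (type_dist xi zeta < d'%:E)%E].
  by apply: iso; exists d'.
have hj := embP j; have hk := embP k.
have hl1 := @seminorm_l1 R m.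
pose K := size s; pose es (i : 'I_K) : E := (nth 0 s i).1.
pose D (u : 'rV[R]_(K + m)) : E := \sum_(i < K) (lsubmx u) 0 i *: es i.
pose B (u : 'rV[R]_(K + m)) : {poly R} := rVpoly (rsubmx u).
have hlsub : linear (fun u : 'rV[R]_(K + m) => lsubmx u).
  by move=> c u v; rewrite linearP.
have hrsub : linear (fun u : 'rV[R]_(K + m) => rsubmx u).
  by move=> c u v; rewrite linearP.
have hD : linear D := linear_compose (linear_comb es) hlsub.
have hB : linear B := linear_compose (@rVpoly_linear R m) hrsub.
pose X := (E * {poly R})%type.
pose gG (x : X) := j x.1 + comb a x.2; pose gH (x : X) := k x.1 + comb b x.2.
have hgG : linear gG.
  apply: linear_add.
    exact: (linear_compose hj (@linear_fst R E {poly R})).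
  exact: (linear_compose (comb_linear a) (@linear_snd R E {poly R})).
have hgH : linear gH.
  apply: linear_add.
    exact: (linear_compose hk (@linear_fst R E {poly R})).
  exact: (linear_compose (comb_linear b) (@linear_snd R E {poly R})).
pose pG x := `|gG x|; pose pH x := `|gH x|.
have hpG : seminorm pG := seminorm_comp (seminorm_norm G) hgG.
have hpH : seminorm pH := seminorm_comp (seminorm_norm H) hgH.
pose Y := ((X * X) * 'rV[R]_m)%type.
pose Q (y : Y) := pH y.1.1 + pG y.1.2 + d * l1 y.2.
pose S (z : E * 'rV[R]_m) : X := (z.1, rVpoly z.2).
have hS : linear S.
  apply: (@linear_pair _ _ _ _ fst); first exact: linear_fst.
  exact: (linear_compose (@rVpoly_linear R m) (@linear_snd R E 'rV[R]_m)).
pose T (z : E * 'rV[R]_m) : Y := ((- S z, S z), z.2).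
have hQ : seminorm Q.
  apply: seminorm_add; first apply: seminorm_add.
  - exact: (seminorm_comp (T := fun y : Y => y.1.1)).
  - exact: (seminorm_comp (T := fun y : Y => y.1.2)).
  - exact: (seminorm_scale (ltW d0)
      (seminorm_comp (T := fun y : Y => y.2) hl1 _)).
have hT : linear T.
  apply: linear_pair; last exact: linear_snd.
  by apply: linear_pair => //; apply: linear_opp.
pose emb (v : 'rV[R]_(K + m) * 'rV[R]_n) : Y :=
  (((D v.1, B v.1), (0, rVpoly v.2)), 0).
have hemb : linear emb.
  have h1 := @linear_fst R 'rV[R]_(K + m) 'rV[R]_n.
  have h2 := @linear_snd R 'rV[R]_(K + m) 'rV[R]_n.
  exact: (linear_pair (linear_pair
    (linear_pair (linear_compose hD h1) (linear_compose hB h1))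
    (linear_pair (@linear_0 R _ E) (linear_compose (@rVpoly_linear R n) h2)))
    (@linear_0 R _ 'rV[R]_m)).
(* The amalgam of the span of [es] and of [b 0, ..., b (m-1)] in [H] with the
   variables standing for [a 0, ..., a (n-1)]: vectors of [E] are the same on
   both sides, and exchanging the variable number [i] for [b i] costs [d]. *)
pose tau v := qsn Q T (emb v).
have htau : seminorm tau := seminorm_comp (seminorm_qsn hQ hT) hemb.
have near z : `|pH (S z) - pG (S z)| <= d * l1 z.2.
  by rewrite -l1p_rVpoly; apply: hb; apply: size_poly.
have tau0 u : tau (u, 0) = `|gH (D u, B u)|.
  apply/eqP; rewrite eq_le; apply/andP; split.
    apply: le_trans (qsn_le0 hQ hT _) _.
    rewrite /Q /emb /= (lin0 (@rVpoly_linear R n)) (sn0 hpG) (sn0 hl1) mulr0.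
    by rewrite !addr0.
  apply: qsn_ge => z; rewrite /Q /emb /T /= !add0r.
  rewrite (lin0 (@rVpoly_linear R n)) -[(0, 0)]/(0 : X) add0r.
  have := snD hpH ((D u, B u) - S z) (S z); rewrite subrK.
  by have := near z; rewrite ler_norml => /andP[? ?]; rewrite {1}/pH; lra.
have [e1 e10 [e11 he1]] :
  exists2 e1, 0 < e1 & e1 <= 1 /\ forall x, x \in s -> e1 * xi x < e.
  pose C := \sum_(x <- s) xi x + 1.
  have xi0 x : 0 <= xi x by apply: sn_ge0; exact: ntype_seminorm.
  have C0 : 0 < C by rewrite ltr_wpDl// sumr_ge0.
  exists (Num.min 1 (e / C)); first by rewrite lt_min ltr01 divr_gt0.
  split=> [|x xs]; first by rewrite ge_min lexx.
  apply: (@le_lt_trans _ _ (e / C * xi x)).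
    by rewrite ler_wpM2r// ge_min lexx orbT.
  rewrite mulrAC ltr_pdivrMr// ltr_pM2l// /C (big_rem _ xs)/=.
  have : 0 <= \sum_(y <- rem x s) xi y by apply: sumr_ge0.
  by lra.
have hh : linear (fun u => gH (D u, B u)).
  exact: (linear_compose hgH (linear_pair hD hB)).
have [c hc hcE] := gurarij_realise Hgur hh htau tau0 e10.
pose b' i := if insub i is Some i' then c (delta_mx 0 i') else 0.
have b'E (w : 'rV[R]_n) : comb b' (rVpoly w) = c w.
  rewrite comb_rVpoly (lin_rowE hc); apply: eq_bigr => i _.
  by rewrite /b' valK.
exists b'; split.
  have /type_dist_lt hdist :
      (type_dist xi (tp k (fun i : 'I_n => b' i)) < d'%:E)%E.
    apply: hs => x xs.
    have xK : (index x s < K)%N by rewrite index_mem.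
    pose i0 := Ordinal xK.
    have es0 : es i0 = x.1 by rewrite /es /= nth_index.
    pose u : 'rV[R]_(K + m) := row_mx (delta_mx 0 i0) 0.
    have Du : D u = x.1.
      rewrite /D row_mxKl (bigD1 i0)//= big1 ?addr0.
        by rewrite mxE !eqxx scale1r es0.
      by move=> l /negPf li; rewrite mxE li andbF scale0r.
    have Bu : B u = 0 by rewrite /B row_mxKr (lin0 (@rVpoly_linear R m)).
    have xiE : xi x = pG (x.1, rVpoly x.2).
      by rewrite /pG /gG /= comb_rVpoly.
    have tauE : tau (u, x.2) = xi x.
      rewrite xiE; apply/eqP; rewrite eq_le; apply/andP; split.
        apply: le_trans (qsn_le T hQ _ (x.1, 0)) _.
        rewrite /Q /emb /T /S /= Du Bu (lin0 (@rVpoly_linear R m)) subrr.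
        rewrite (sn0 hpH) !add0r (sn0 hl1) mulr0 addr0.
        by rewrite -[(0, _) + _]/(0 + x.1, rVpoly x.2 + 0) add0r addr0.
      apply: qsn_ge => z; rewrite /Q /emb /T /= add0r Du Bu.
      have -> : (0, rVpoly x.2) + S z =
          (x.1, rVpoly x.2) - ((x.1, 0) - S z) :> X.
        rewrite opprB addrCA addrC; congr (_ + _).
        by rewrite -[RHS]/(x.1 - x.1, rVpoly x.2 - 0) subrr subr0.
      have hz : (x.1, 0) - S z = S (x.1 - z.1, - z.2) :> X.
        rewrite /S /= (linN (@rVpoly_linear R m)).
        by rewrite -[LHS]/(_ - _, 0 - _) sub0r.
      have := near (x.1 - z.1, - z.2); rewrite -hz /= (snN hl1).
      have := snD hpG ((x.1, rVpoly x.2) - ((x.1, 0) - S z)) ((x.1, 0) - S z).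
      rewrite subrK ler_norml => ? /andP[? ?]; lra.
    have := hcE u x.2; rewrite tauE Du Bu -b'E.
    have -> : gH (x.1, 0) + comb b' (rVpoly x.2) =
        eval_tuple k (fun i : 'I_n => b' i) x.
      by rewrite /gH /= (lin0 (comb_linear b)) addr0 comb_rVpoly.
    by move=> h; apply: le_lt_trans h (he1 x xs).
  move=> x f fn; have := hdist (x, poly_rV f).
  by rewrite /= /eval_tuple /= -!comb_rVpoly -l1p_rVpoly !poly_rV_K// distrC.
move=> i im; have iN := leq_trans im mn.
have -> : b' i = c (delta_mx 0 (Ordinal iN)).
  by rewrite /b'; case: insubP => [i' _ /= ii'|]; rewrite ?iN//;
    congr (c (delta_mx _ _)); apply: val_inj.
pose u : 'rV[R]_(K + m) := row_mx 0 (- delta_mx 0 (Ordinal im)).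
have Du : D u = 0.
  by rewrite /D row_mxKl big1// => l _; rewrite mxE scale0r.
have Bu : B u = - 'X^i.
  by rewrite /B row_mxKr (linN (@rVpoly_linear R m)) rVpoly_delta.
have hu : gH (D u, B u) = - b i.
  by rewrite /gH /= Du Bu (lin0 hk) (linN (comb_linear b)) combXn add0r.
have tauu : tau (u, delta_mx 0 (Ordinal iN)) <= d.
  apply: le_trans (qsn_le T hQ _ (0, - delta_mx 0 (Ordinal im))) _.
  rewrite /Q /emb /T /S /= Du Bu !rVpoly_delta.
  rewrite (linN (@rVpoly_linear R m)) !rVpoly_delta /= add0r (snN hl1).
  rewrite -[(0, - 'X^i) - _]/(0 - 0, - 'X^i - (- 'X^i)) !subrr (sn0 hpH).
  by rewrite -[(0, _) + _]/(0 + 0, 'X^i - 'X^i) addr0 subrr (sn0 hpG) l1_delta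
    mulr1 !add0r.
have := hcE u (delta_mx 0 (Ordinal iN)); rewrite hu (addrC (- b i)) ler_norml.
move=> /andP[_]; have tau_ge0 := sn_ge0 htau (u, delta_mx 0 (Ordinal iN)).
by have := ler_wpM2r tau_ge0 e11; lra.
Qed.

End AtomicPrime.

Lemma pow2_small (R : realType) (e : R) : 0 < e ->
  exists N, forall n, (N <= n)%N -> 2^-1 ^+ n <= e.
Proof.
move=> /inv_small[N hN]; exists N => n /hN; apply: le_trans.
rewrite exprVn lef_pV2 ?posrE ?exprn_gt0// -natrX ler_nat.
exact: ltn_expl.
Qed.

Section AtomicIsPrime.
Variables (R : realType) (E G : completeNormedModType R) (j : embedding E G).

(** Finite tuples of [H] that are ever closer to realising the types of the
    initial segments of a dense sequence [a] of [G] are chosen successively,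
    each moving the entries of the previous one by a summable amount only.  The
    entrywise limits realise these types exactly. *)
Lemma separable_atomic_prime : separable G -> atomic_over j -> prime_over j.
Proof.
move=> /separable_seq[a adense] atom H k Hgur.
pose d m : R := 2^-1 ^+ m.
have d0 m : 0 < d m by rewrite exprn_gt0.
have dS m : d m.+1 = d m / 2 by rewrite /d exprSr.
have step (mb : nat * (nat -> H)) : exists b' : nat -> H,
    close_types j k a mb.1 mb.2 (d mb.1) ->
    close_types j k a mb.1.+1 b' (d mb.1.+1) /\
    forall i, (i < mb.1)%N -> `|b' i - mb.2 i| <= 2 * d mb.1.
  have [hb|nb] := pselect (close_types j k a mb.1 mb.2 (d mb.1)); last first.
    by exists (fun=> 0).
  have [b' hb'] := close_types_step Hgur (leqnSn mb.1) (atom _ _)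
    (d0 mb.1) (d0 mb.1.+1) hb.
  by exists b'.
have [next hnext] := choice step.
pose b := fix b m := if m is m'.+1 then next (m', b m') else fun=> 0.
have hb m : close_types j k a m (b m) (d m).
  elim: m => [|m IH]; last by have [] := hnext (m, b m) IH.
  move=> x f; rewrite leqn0 size_poly_eq0 => /eqP->.
  rewrite !(lin0 (comb_linear _)) !addr0 !emb_isometric subrr normr0.
  by apply: mulr_ge0; [exact: ltW|exact: l1p_ge0].
have bstep m i : (i < m)%N -> `|b m.+1 i - b m i| <= 2 * d m.
  by move=> im; have [_] := hnext (m, b m) (hb m); apply.
have btail m l i : (i < m)%N -> `|b (m + l)%N i - b m i| <= 4 * d m.
  move=> im; suff : `|b (m + l)%N i - b m i| <= 4 * (d m - d (m + l)%N).
    by have := d0 (m + l)%N; lra.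
  elim: l => [|l IH]; first by rewrite addn0 !subrr normr0 mulr0.
  have := bstep (m + l)%N i (ltn_addr _ im); rewrite addnS dS.
  by have := ler_distD (b (m + l)%N i) (b (m + l).+1 i) (b m i); lra.
have /choice[binf hbinf] : forall i, exists y, forall e, 0 < e ->
    exists N, forall m, (N <= m)%N -> `|b m i - y| <= e.
  move=> i; apply: (@cauchy_limit _ _ (fun m => b m i)) => e e0.
  have [|N hN] := @pow2_small R (e / 8); first lra.
  pose M := maxn N i.+1.
  have dM : d M <= e / 8 by apply: hN; rewrite leq_maxl.
  have iM : (i < M)%N by rewrite leq_maxr.
  exists M => m l Mm Ml.
  have := btail M (m - M)%N i iM; have := btail M (l - M)%N i iM.
  rewrite !subnKC// (distrC (b l i)).
  by have := ler_distD (b M i) (b m i) (b l i); lra.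
have binfE x f : `|k x + comb binf f| = `|j x + comb a f|.
  apply/eqP; rewrite -subr_eq0 -normr_le0; apply/ler_addgt0Pr => e e0.
  rewrite add0r; have f0 := l1p_ge0 f.
  have e1 : 0 < e / 2 / (l1p f + 1) by rewrite !divr_gt0// ltr_wpDl.
  have e1f : e / 2 / (l1p f + 1) * l1p f <= e / 2.
    by rewrite mulrAC ler_pdivrMr ?ltr_wpDl// ler_wpM2l; lra.
  have [N hN] := pow2_small e1.
  have /choice[M hM] := fun i => hbinf i _ e1.
  pose m := maxn N (maxn (size f) (\max_(i < size f) M i)).
  have Nm : (N <= m)%N by rewrite leq_maxl.
  have fm : (size f <= m)%N by rewrite /m !leq_max leqnn orbT.
  have Mm i : (i < size f)%N -> (M i <= m)%N.
    move=> fi; rewrite /m !leq_max.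
    rewrite (leq_bigmax (F := fun i : 'I_(size f) => M i) (Ordinal fi)).
    by rewrite !orbT.
  have h1 := hb m x f fm.
  have h2 : `|comb (b m) f - comb binf f| <= e / 2 / (l1p f + 1) * l1p f.
    by apply: comb_lip (leqnn _) _ => i fi; apply: hM; apply: Mm.
  have h3 : d m * l1p f <= e / 2 / (l1p f + 1) * l1p f.
    by rewrite ler_wpM2r// hN.
  have := ler_dist_dist (k x + comb (b m) f) (k x + comb binf f).
  rewrite opprD addrACA subrr add0r => h4.
  have := ler_distD `|k x + comb (b m) f|
    `|k x + comb binf f| `|j x + comb a f|.
  by rewrite (distrC `|k x + comb binf f| `|k x + comb (b m) f|); lra.
pose X := (E * {poly R})%type.
have h1 := @linear_fst R E {poly R}; have h2 := @linear_snd R E {poly R}.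
have lG : linear (fun x : X => j x.1 + comb a x.2).
  exact: (linear_add (linear_compose (embP j) h1)
    (linear_compose (comb_linear a) h2)).
have lH : linear (fun x : X => k x.1 + comb binf x.2).
  exact: (linear_add (linear_compose (embP k) h1)
    (linear_compose (comb_linear binf) h2)).
have [||f hf] := extend_isometry lG lH.
- by move=> x; apply: binfE.
- move=> y e /(adense y)[n hn]; exists (0, 'X^n).
  by rewrite /= linear0 add0r combXn.
exists f => x; have := hf (x, 0).
by rewrite /= !(lin0 (comb_linear _)) !addr0.
Qed.

End AtomicIsPrime.

(** * Finite nets for seminorms *)

Section Nets.
Variable R : realType.

Lemma nat_fracP (M : nat) (x : R) : (0 < M)%N -> 0 <= x ->
  0 <= x - (Num.truncn (x * M%:R))%:R / M%:R <= M%:R^-1.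
Proof.
move=> M0 x0; have M0' : 0 < M%:R :> R by rewrite ltr0n.
have /truncn_itv/andP[h1 h2] : 0 <= x * M%:R by rewrite mulr_ge0// ltW.
apply/andP; split; first by rewrite subr_ge0 ler_pdivrMr.
rewrite -[leRHS]mul1r ler_pdivlMr// mulrBl divfK ?gt_eqF//.
by move: h2; rewrite -natr1; lra.
Qed.

(** Seminorms that are bounded on the basis vectors are equi-Lipschitz, so
    that closeness on a fine enough grid gives closeness everywhere. *)
Lemma seminorm_net n (C e : R) : 0 < e ->
  exists (s : seq 'rV[R]_n) (e1 : R), 0 < e1 /\
    forall p q : 'rV[R]_n -> R, seminorm p -> seminorm q ->
      (forall i, p (delta_mx 0 i) <= C) ->
      (forall v, v \in s -> `|q v - p v| <= e1) ->
      forall v, `|q v - p v| <= e * l1 v.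
Proof.
move=> e0; pose e1 := e / 2; have e10 : 0 < e1 by rewrite /e1; lra.
(* [A] is a Lipschitz constant for [p + q] with respect to the l1 norm. *)
pose A := 2 * `|C| + e1.
have A0 : 0 <= A by have := normr_ge0 C; rewrite /A; lra.
have An0 : 0 < A * n%:R + 1 by rewrite ltr_wpDl// mulr_ge0.
have [N hN] := inv_small (divr_gt0 e10 An0).
have {hN} := hN N (leqnn N); set M := N.+1 => hM.
have M0 : 0 < M%:R :> R by rewrite ltr0n.
pose grid (g : {ffun 'I_n -> 'I_(2 * M).+1}) : 'rV[R]_n :=
  \row_i ((g i)%:R / M%:R - 1).
exists ([seq delta_mx 0 i | i <- enum 'I_n] ++
  [seq grid g | g <- enum {ffun 'I_n -> 'I_(2 * M).+1}]), e1.
split=> // p q hp hq hpC hpq.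
have pC i : p (delta_mx 0 i) <= `|C| by apply: le_trans (hpC i) (ler_norm C).
have qC i : q (delta_mx 0 i) <= `|C| + e1.
  have := hpq (delta_mx 0 i); rewrite mem_cat map_f ?mem_enum//= => /(_ isT).
  by rewrite ler_norml => /andP[_]; have := pC i; lra.
have unit_ball v : l1 v <= 1 -> `|q v - p v| <= e.
  move=> v1; have vi i : `|v 0 i| <= 1.
    apply: le_trans v1; rewrite /l1 (bigD1 i)//=.
    have : 0 <= \sum_(k < n | k != i) `|v 0 k| by apply: sumr_ge0.
    by lra.
  have v0 i : 0 <= v 0 i + 1 by have := vi i; rewrite ler_norml; lra.
  have vg i : (Num.truncn ((v 0 i + 1) * M%:R)%R < (2 * M).+1)%N.
    rewrite ltnS -(ler_nat R) natrM.
    have /truncn_itv/andP[h1 _] : 0 <= (v 0 i + 1) * M%:R.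
      by rewrite mulr_ge0// ltW.
    apply: le_trans h1 _; rewrite ler_pM2r//.
    by have := vi i; rewrite ler_norml; lra.
  pose w := grid [ffun i => Ordinal (vg i)].
  have vw : l1 (v - w) <= n%:R / M%:R.
    rewrite /l1 mulr_natl -[X in _ *+ X]card_ord -sumr_const.
    apply: ler_sum => i _; rewrite !mxE ffunE /=.
    have /andP[h1 h2] := nat_fracP (isT : (0 < M)%N) (v0 i).
    move: h1 h2; set y := _ / M%:R; move: y M%:R^-1 => y z h1 h2.
    by rewrite ger0_norm; lra.
  have w_in : `|q w - p w| <= e1.
    by apply: hpq; rewrite mem_cat (map_f grid) ?orbT ?mem_enum.
  have h1 := sn_row_le hp pC (v - w); have h2 := sn_row_le hq qC (v - w).
  have h3 : A * l1 (v - w) <= e1.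
    apply: le_trans (ler_wpM2l A0 vw) _; rewrite mulrA.
    apply: le_trans (ler_wpM2l _ hM) _; first by rewrite mulr_ge0.
    rewrite mulrCA ler_piMr ?(ltW e10)// ler_pdivrMr// mul1r; lra.
  have /ler_normlP[? ?] := sn_dist hp v w.
  have /ler_normlP[? ?] := sn_dist hq v w.
  move: w_in h3; rewrite /A !ler_norml => /andP[? ?] ?.
  have : (2 * `|C| + e1) * l1 (v - w) =
    `|C| * l1 (v - w) + (`|C| + e1) * l1 (v - w) by lra.
  by move=> ?; have : e = e1 + e1 by [rewrite /e1; lra]; move=> ?;
    apply/andP; split; lra.
move=> v; have [v0|v0] := eqVneq (l1 v) 0.
  have := sn_row_le hp pC v; have := sn_row_le hq qC v.
  have := sn_ge0 hp v; have := sn_ge0 hq v.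
  rewrite v0 !mulr0 => ? ? ? ?.
  have -> : q v = 0 by lra.
  have -> : p v = 0 by lra.
  by rewrite subrr normr0.
have vpos : 0 < l1 v by rewrite lt_def v0 (sn_ge0 (@seminorm_l1 R n)).
have vE : v = l1 v *: ((l1 v)^-1 *: v) by rewrite scalerA divff// scale1r.
rewrite {1 2}vE (snZ hp) (snZ hq) -mulrBr normrM normr_id.
rewrite (ger0_norm (ltW vpos)).
rewrite mulrC ler_pM2r//; apply: unit_ball.
by rewrite (snZ (@seminorm_l1 R n)) normfV ger0_norm ?mulVf// ltW.
Qed.

(** Values on a finite net, rounded to a grid, determine a seminorm up to a
    small error: hence the separability of the space of seminorms. *)
Lemma seminorm_separable n : exists t : nat -> 'rV[R]_n -> R,
  (forall i, seminorm (t i)) /\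
  forall p e, seminorm p -> 0 < e ->
    exists i, forall v, `|p v - t i v| <= e * l1 v.
Proof.
have /choice[net hnet] : forall Ck : nat * nat,
    exists se : seq 'rV[R]_n * R, 0 < se.2 /\
    forall p q : 'rV[R]_n -> R, seminorm p -> seminorm q ->
      (forall i, p (delta_mx 0 i) <= Ck.1%:R) ->
      (forall v, v \in se.1 -> `|q v - p v| <= se.2) ->
      forall v, `|q v - p v| <= Ck.2.+1%:R^-1 * l1 v.
  move=> [C k]; have [|s [e1 h]] := @seminorm_net n C%:R k.+1%:R^-1.
    by rewrite invr_gt0.
  by exists (s, e1).
pose good (c : nat * nat * seq nat) (p : 'rV[R]_n -> R) :=
  [/\ seminorm p, forall i, p (delta_mx 0 i) <= c.1.1%:R &
      forall i, (i < size (net c.1).1)%N ->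
        `|p (nth 0 (net c.1).1 i) - (nth 0%N c.2 i)%:R * (net c.1).2 / 2|
          <= (net c.1).2 / 2].
have /choice[t ht] : forall m : nat, exists p : 'rV[R]_n -> R, seminorm p /\
    forall c, unpickle m = Some c -> (exists q, good c q) -> good c p.
  move=> m; case E : (unpickle m) => [c|]; last first.
    by exists (@l1 R n); split=> //; apply: seminorm_l1.
  have [[q hq]|nq] := pselect (exists q, good c q).
    by exists q; split; [case: hq|move=> _ [<-]].
  by exists (@l1 R n); split; [apply: seminorm_l1|move=> _ [<-]].
exists t; split=> [i|p e hp e0]; first by case: (ht i).
have [k hk] := inv_small e0.
pose C := (Num.truncn (\sum_(i < n) p (delta_mx 0 i))).+1.
have pC i : p (delta_mx 0 i) <= C%:R.
  have S0 : 0 <= \sum_(i < n) p (delta_mx 0 i).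
    by apply: sumr_ge0 => i' _; apply: sn_ge0.
  have /truncn_itv/andP[_ /ltW] := S0; apply: le_trans.
  rewrite (bigD1 i)//=.
  have : 0 <= \sum_(k < n | k != i) p (delta_mx 0 k).
    by apply: sumr_ge0 => i' _; apply: sn_ge0.
  by lra.
have [] := hnet (C, k); case E : (net (C, k)) => [s e1] /= e10 hs.
pose vals := [seq Num.truncn (p x / (e1 / 2)) | x <- s].
pose c := ((C, k), vals).
have round x : 0 <= p x - (Num.truncn (p x / (e1 / 2)))%:R * e1 / 2 <= e1 / 2.
  have e20 : 0 < e1 / 2 by lra.
  have /truncn_itv : 0 <= p x / (e1 / 2).
    by apply: divr_ge0; [exact: sn_ge0|exact: ltW].
  by rewrite ler_pdivlMr// ltr_pdivrMr// -natr1; lra.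
have gp : good c p.
  split=> // i; rewrite E /= => is_; rewrite (nth_map 0)//.
  by have /andP[? ?] := round (nth 0 s i); rewrite ger0_norm.
have [htc /(_ c)] := ht (pickle c).
rewrite pickleK => /(_ erefl) h; have {h}[_ _ h] := h (ex_intro _ p gp).
exists (pickle c) => v; rewrite distrC.
apply: (@le_trans _ _ (k.+1%:R^-1 * l1 v)); last first.
  by apply: ler_wpM2r (hk _ (leqnn k)); apply: sn_ge0 (@seminorm_l1 R n) _.
apply: hs => // x xs.
have is_ : (index x s < size s)%N by rewrite index_mem.
have := h (index x s); rewrite E /= => /(_ is_).
rewrite (nth_map 0)// nth_index// ler_norml => /andP[? ?].
by have /andP[? ?] := round x; rewrite ler_norml; apply/andP; split; lra.
Qed.

End Nets.

(** * Generic seminorms *)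

Section Forcing.
Variables (R : realType) (E : completeNormedModType R) (d : nat -> E).
Local Notation V := (E * {poly R})%type.
Implicit Types (p q : V -> R).

Hypothesis ddense : forall x e, 0 < e -> exists n, `|x - d n| <= e.

(** The vectors used at stage [m] are those of the span of [d 0, ..., d
    (m-1)] and of the first [m] variables; the error is measured by the l1
    norm of the coefficients with respect to these generators, which may be
    dependent. *)
Definition within p q m e := forall b f : {poly R},
  (size b <= m)%N -> (size f <= m)%N ->
  `|p (comb d b, f) - q (comb d b, f)| <= e * (l1p b + l1p f).

(** A condition stands for the set of all seminorms that extend the norm of
    [E] and are [within] the bound [cerr] of [cnorm] on the vectors used at
    stage [cstage]. *)
Record cond := Cond {
  cstage : nat;
  cnorm :> V -> R;
  cerr : R;
  cond_sn : seminorm cnorm;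
  cond_ext : forall b : E, cnorm (b, 0) = `|b|;
  cerr_gt0 : 0 < cerr }.
Implicit Types P Q : cond.

Definition meets p P := within p P (cstage P) (cerr P).

(** The third clause is what makes every seminorm that [meets] [Q] also meet
    [P]. *)
Definition refines Q P := [/\ (cstage P <= cstage Q)%N, cerr Q <= cerr P &
  within Q P (cstage P) (cerr P - cerr Q)].

Lemma within_exact p q m (e : R) : 0 <= e ->
  (forall (b : E) (f : {poly R}), (size f <= m)%N -> p (b, f) = q (b, f)) ->
  within p q m e.
Proof.
move=> e0 pq b f bm fm; rewrite pq// subrr normr0.
by rewrite mulr_ge0// addr_ge0// l1p_ge0.
Qed.

Lemma refines_trans P Q S : refines S Q -> refines Q P -> refines S P.
Proof.
move=> [m1 e1 h1] [m2 e2 h2]; split.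
- exact: leq_trans m2 m1.
- exact: le_trans e1 e2.
move=> b f bm fm.
have := h1 b f (leq_trans bm m2) (leq_trans fm m2); have := h2 b f bm fm.
have := ler_distD (Q (comb d b, f)) (S (comb d b, f)) (P (comb d b, f)).
rewrite !mulrBl; lra.
Qed.

Lemma cond_lip P (b b' : E) (f : {poly R}) :
  `|P (b, f) - P (b', f)| <= `|b - b'|.
Proof.
apply: le_trans (sn_dist (cond_sn P) _ _) _.
by rewrite -[(b, f) - (b', f)]/(b - b', f - f) subrr cond_ext.
Qed.

Lemma refine_exact P m (q : V -> R) (e : R) : (cstage P <= m)%N ->
  seminorm q ->
  (forall (b : E) (f : {poly R}), (size f <= cstage P)%N ->
    q (b, f) = P (b, f)) ->
  0 < e -> e <= cerr P ->
  exists Q, [/\ refines Q P, cstage Q = m, cerr Q = e & cnorm Q = q].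
Proof.
move=> Pm hq qP e0 eP.
have qext b : q (b, 0) = `|b| by rewrite qP ?size_poly0// cond_ext.
exists (Cond m hq qext e0); split=> //; split=> //=.
by apply: within_exact => //; rewrite subr_ge0.
Qed.

Lemma shrink P m e : 0 < e -> exists Q,
  [/\ refines Q P, (m <= cstage Q)%N & cerr Q <= e].
Proof.
move=> e0; have [|||||Q [QP Qm Qe _]] :=
  @refine_exact P (maxn m (cstage P)) P (Num.min e (cerr P)).
- by rewrite leq_maxr.
- exact: cond_sn.
- by [].
- by rewrite lt_min e0 cerr_gt0.
- by rewrite ge_min lexx orbT.
- exists Q; split=> //; first by rewrite Qm leq_maxl.
  by rewrite Qe ge_min lexx.
Qed.

Lemma start_sn : seminorm (fun x : V => `|x.1|).
Proof.
exact: (seminorm_comp (seminorm_norm E) (@linear_fst R E {poly R})).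
Qed.

Lemma limit_le (u v w : nat -> R) (x y z : R) :
  (forall e, 0 < e -> exists N, forall k, (N <= k)%N -> `|u k - x| <= e) ->
  (forall e, 0 < e -> exists N, forall k, (N <= k)%N -> `|v k - y| <= e) ->
  (forall e, 0 < e -> exists N, forall k, (N <= k)%N -> `|w k - z| <= e) ->
  (exists N, forall k, (N <= k)%N -> u k <= v k + w k) -> x <= y + z.
Proof.
move=> hu hv hw [M hM]; apply/ler_addgt0Pr => e e0.
have e30 : 0 < e / 3 by lra.
have [N1 h1] := hu _ e30; have [N2 h2] := hv _ e30; have [N3 h3] := hw _ e30.
pose k := maxn (maxn M N1) (maxn N2 N3).
have := hM k; have := h1 k; have := h2 k; have := h3 k.
rewrite /k !leq_max !leqnn !orbT => /(_ isT) + /(_ isT) + /(_ isT) + /(_ isT).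
by rewrite !ler_norml => /andP[? ?] /andP[? ?] /andP[? ?]; lra.
Qed.

(** A countable family of dense sets of conditions is met by a single seminorm.
    Along a sequence of successive refinements that enters these sets in turn,
    with stages growing and errors tending to [0], the seminorms converge: on
    the combinations of the generators because of the third clause of
    [refines], and everywhere because they are 1-Lipschitz in the coordinate in
    [E]. *)
Lemma generic_seminorm (D : nat -> cond -> Prop) :
  (forall i P, exists Q, refines Q P /\ D i Q) ->
  exists p, [/\ seminorm p, forall b, p (b, 0) = `|b| &
    forall i, exists Q, D i Q /\ meets p Q].
Proof.
move=> Ddense.
have /choice[nx hnx] : forall kP : nat * cond, exists Q,
    [/\ refines Q kP.2, D kP.1 Q, (kP.1 <= cstage Q)%N &
        cerr Q <= kP.1.+1%:R^-1].
  move=> [k P] /=; have [|Q [QP Qk Qe]] := @shrink P k k.+1%:R^-1.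
    by rewrite invr_gt0.
  have [S [SQ DS]] := Ddense k Q; exists S; split=> //.
  - exact: refines_trans SQ QP.
  - by case: SQ => h _ _; apply: leq_trans Qk h.
  - by case: SQ => _ h _; apply: le_trans h Qe.
pose P0 : cond := @Cond 0 _ 1 start_sn (fun b => erefl) ltr01.
pose P := fix P k := if k is k'.+1 then nx (k', P k') else P0.
have Pk k : [/\ D k (P k.+1), (k <= cstage (P k.+1))%N &
    cerr (P k.+1) <= k.+1%:R^-1] by have [] := hnx (k, P k).
have Pref k l : (k <= l)%N -> refines (P l) (P k).
  move=> /subnK <-; elim: (l - k)%N => [|i IH].
    split=> //; apply: within_exact => //; by rewrite subrr.
  rewrite addSn; apply: refines_trans IH.
  by have [] := hnx ((i + k)%N, P (i + k)%N).
have Pcauchy x e : 0 < e -> exists N, forall k l, (N <= k)%N -> (N <= l)%N ->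
    `|P k x - P l x| <= e.
  case: x => b f e0; have [|i hi] := @ddense b (e / 8); first lra.
  pose C : R := 1 + l1p f; have C0 : 0 < C by rewrite ltr_pwDl// l1p_ge0.
  have [|N hN] := @inv_small R (e / 4 / C); first by rewrite !divr_gt0.
  pose M := maxn N (maxn i.+1 (size f)).
  have [_ MM eM] := Pk M.
  have iM : (i < cstage (P M.+1))%N.
    by apply: leq_trans MM; rewrite /M !leq_max leqnn orbT.
  have fM : (size f <= cstage (P M.+1))%N.
    by apply: leq_trans MM; rewrite /M !leq_max leqnn !orbT.
  have near k : (M.+1 <= k)%N -> `|P k (d i, f) - P M.+1 (d i, f)| <= e / 4.
    move=> Mk; have [_ eMk h] := Pref _ _ Mk.
    have := h 'X^i f; rewrite size_polyXn combXn l1pXn => /(_ iM fM).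
    move=> /le_trans; apply; apply: (@le_trans _ _ (e / 4 / C * C)); last first.
      by rewrite divfK// gt_eqF.
    rewrite ler_wpM2r ?(ltW C0)//; apply: le_trans (hN M _); last first.
      by rewrite leq_maxl.
    by apply: le_trans eM; rewrite lerBlDr lerDl ltW// cerr_gt0.
  have lip k : `|P k (b, f) - P k (d i, f)| <= e / 8.
    exact: le_trans (cond_lip _ _ _ _) hi.
  exists M.+1 => k l /near hk /near hl.
  have := lip k; have := lip l; move: hk hl; rewrite !ler_norml.
  by move=> /andP[? ?] /andP[? ?] /andP[? ?] /andP[? ?]; apply/andP; split; lra.
have /choice[p hp] : forall x, exists y : R, forall e, 0 < e ->
    exists N, forall k, (N <= k)%N -> `|P k x - y| <= e.
  by move=> x; apply: (@cauchy_limit R R (fun k => P k x)); apply: Pcauchy.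
have cst (y : R) e : 0 < e ->
    exists N : nat, forall k, (N <= k)%N -> `|y - y| <= e.
  by move=> e0; exists 0%N => k _; rewrite subrr normr0 ltW.
have pdist x y c : (exists N, forall k, (N <= k)%N -> `|P k x - y| <= c) ->
    `|p x - y| <= c.
  move=> [N hN]; rewrite ler_norml; apply/andP; split; last first.
    rewrite lerBlDl.
    apply: (limit_le (u := fun k => P k x) (v := fun=> y) (w := fun=> c)) (hp x)
      (cst y) (cst c) _.
    by exists N => k /hN; rewrite ler_norml => /andP[_]; lra.
  rewrite lerBrDl lerBlDr.
  apply: (limit_le (u := fun=> y) (v := fun k => P k x) (w := fun=> c)) (cst y)
    (hp x) (cst c) _.
  by exists N => k /hN; rewrite ler_norml => /andP[]; lra.
exists p; split.
- split=> [x y|a x].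
    apply: (limit_le (u := fun k => P k (x + y)) (v := fun k => P k x)
      (w := fun k => P k y)) (hp _) (hp x) (hp y) _.
    by exists 0%N => k _; apply: snD (cond_sn _) _ _.
  apply/eqP; rewrite -subr_eq0 -normr_le0; apply/ler_addgt0Pr => e e0.
  rewrite add0r; apply: pdist.
  have [c c0 ac] := scale_bound a e0.
  have [N hN] := hp x _ c0; exists N => k /hN h.
  rewrite (snZ (cond_sn _)) -mulrBr normrM normr_id.
  exact: le_trans (ler_wpM2l (normr_ge0 a) h) ac.
- move=> b; apply/eqP; rewrite -subr_eq0 -normr_le0; apply: pdist.
  by exists 0%N => k _; rewrite cond_ext subrr normr0.
- move=> i; exists (P i.+1); split; first by have [] := Pk i.
  move=> b f bm fm; apply: pdist; exists i.+1 => k ik.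
  have [_ _ /(_ b f bm fm)/le_trans] := Pref _ _ ik; apply.
  by rewrite ler_wpM2r ?addr_ge0 ?l1p_ge0// lerBlDl lerDr ltW// cerr_gt0.
Qed.

End Forcing.

Section DenseSets.
Variables (R : realType) (E : completeNormedModType R) (d : nat -> E).
Local Notation V := (E * {poly R})%type.
Local Notation cond := (cond E).
Local Notation refines := (refines d).
Local Notation meets := (meets d).
Implicit Types (p : V -> R) (P Q : cond) (f : {poly R}).

Lemma size_leD (f g : {poly R}) m : (size f <= m)%N -> (size g <= m)%N ->
  (size (f + g)%R <= m)%N.
Proof.
by move=> fm gm; apply: leq_trans (size_polyD _ _) _; rewrite geq_max fm.
Qed.

Definition near_variable i f e Q := exists g : nat,
  [/\ (i < cstage Q)%N, (size f <= cstage Q)%N, (g < cstage Q)%N &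
      Q (d i, f - 'X^g) + cerr Q * (1 + l1p (f - 'X^g)) <= e].

(** A variable not used by the condition is made to coincide with the given
    vector. *)
Lemma near_variable_dense i f e : 0 < e ->
  forall P, exists Q, refines Q P /\ near_variable i f e Q.
Proof.
move=> e0 P; pose m := maxn (cstage P) (maxn i.+1 (size f)).
have Pm : (cstage P <= m)%N by rewrite leq_maxl.
have im : (i < m)%N by rewrite /m !leq_max leqnn orbT.
have fm : (size f <= m)%N by rewrite /m !leq_max leqnn !orbT.
pose T (x : V) : V := (x.1, take_poly m x.2) + x.2`_m *: (d i, f).
have h1 := @linear_fst R E {poly R}; have h2 := @linear_snd R E {poly R}.
have hT : linear T.
  apply: linear_add.
    apply: (linear_pair h1); apply: linear_compose h2 => a u v.
    by rewrite linearP.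
  by move=> a x y; rewrite coefD coefZ scalerDl scalerA.
pose C := 1 + l1p (f - 'X^m).
have C0 : 0 < C by rewrite ltr_pwDl// l1p_ge0.
have [|||||Q [QP Qm Qe Qn]] := @refine_exact _ _ d P m.+1 (fun x => P (T x))
    (Num.min (cerr P) (e / C)).
- exact: leqW.
- exact: seminorm_comp (cond_sn P) hT.
- move=> b h hP; congr (cnorm P _); rewrite /T /=.
  have hm := leq_trans hP Pm.
  by rewrite take_poly_id// nth_default// scale0r addr0.
- by rewrite lt_min cerr_gt0 divr_gt0.
- by rewrite ge_min lexx.
exists Q; split=> //; exists m; rewrite Qm; split=> //.
- exact: ltnW.
- exact: leqW.
- rewrite Qn -/C.
  have -> : T (d i, f - 'X^m) = 0.
    rewrite /T /= coefB coefXn eqxx nth_default// sub0r scaleN1r.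
    rewrite linearB /= take_poly_id//.
    have -> : take_poly m ('X^m : {poly R}) = 0.
      apply/polyP => k; rewrite coef_take_poly coefXn coef0.
      by case: ltnP => // /ltn_eqF ->.
    by rewrite subr0 subrr.
  rewrite (sn0 (cond_sn P)) add0r Qe -ler_pdivlMr//.
  by rewrite ge_min lexx orbT.
Qed.

Lemma near_variable_meets i f e p Q : near_variable i f e Q -> meets p Q ->
  exists g : nat, p (d i, f - 'X^g) <= e.
Proof.
move=> [g [im fm gm hQ]] /(_ 'X^i (f - 'X^g)).
rewrite combXn l1pXn size_polyXn => /(_ im) hp; exists g.
have {hp}/hp : (size (f - 'X^g)%R <= cstage Q)%N.
  by apply: size_leD; rewrite ?size_polyN ?size_polyXn.
by rewrite ler_norml => /andP[_]; lra.
Qed.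

Definition vars n (c : nat -> nat) (u : 'rV[R]_n) : {poly R} :=
  \sum_(i < n) u 0 i *: 'X^(c i).

Lemma vars_linear n c : linear (@vars n c).
Proof. exact: linear_comb. Qed.

Lemma size_vars n c u m : (forall i, (i < n)%N -> (c i < m)%N) ->
  (size (@vars n c u) <= m)%N.
Proof.
move=> hc; apply: leq_trans (size_sum _ _ _) _; apply/bigmax_leqP => i _.
by apply: leq_trans (size_scale_leq _ _) _; rewrite size_polyXn hc.
Qed.

Lemma l1p_vars n c u : l1p (@vars n c u) <= l1 u.
Proof.
apply: le_trans (sn_sum (@seminorm_l1p R) _ _) _; apply: ler_sum => i _.
by rewrite (snZ (@seminorm_l1p R)) l1pXn mulr1.
Qed.

(** If the variables [c] nearly realise the restriction of [t], then variables
    [g] can be found that nearly realise the extension that [t] prescribes. *)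
Definition realises_extension n l c (t : 'rV[R]_n * 'rV[R]_l -> R) (e : R) Q :=
  [/\ forall i, (i < n)%N -> (c i < cstage Q)%N, cerr Q <= e &
      (forall u, `|Q (0, vars c u) - t (u, 0)| <= 2 * e * l1 u) ->
      exists g : nat -> nat, (forall i, (i < l)%N -> (g i < cstage Q)%N) /\
        forall u v, `|Q (0, vars c u + @vars l g v) - t (u, v)|
          <= 2 * e * (l1 u + l1 v)].

(** Variables not used by the condition are given the required type by
    amalgamation.  Adding an l1 error to [t] makes it dominate the seminorm of
    the condition on the common part, so that the amalgam extends the latter
    exactly. *)
Lemma amalgam_dense n l c t e : seminorm t -> 0 < e ->
  forall P, exists Q, refines Q P /\ @realises_extension n l c t e Q.
Proof.
move=> ht e0 P0.
have [P [PP0 mP eP]] := shrink d P0 (\max_(i < n) (c i).+1) e0.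
have cP i : (i < n)%N -> (c i < cstage P)%N.
  move=> i_n; apply: leq_trans mP.
  exact: (leq_bigmax (F := fun i : 'I_n => (c i).+1) (Ordinal i_n)).
have [near|nnear] := pselect
    (forall u, `|P (0, vars c u) - t (u, 0)| <= 2 * e * l1 u); last first.
  by exists P; split=> //; split.
pose m := cstage P.
have hl1n := @seminorm_l1 R n; have hl1l := @seminorm_l1 R l.
have e20 : 0 <= 2 * e by lra.
pose W := ('rV[R]_n * 'rV[R]_l)%type.
pose r (w : W) := t w + 2 * e * (l1 w.1 + l1 w.2).
have hr : seminorm r.
  apply: seminorm_add => //; apply: seminorm_scale => //; apply: seminorm_add.
    exact: (seminorm_comp (T := fun w : W => w.1) hl1n).
  exact: (seminorm_comp (T := fun w : W => w.2) hl1l).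
pose Y := (V * W)%type.
pose N (y : Y) := P y.1 + r y.2.
have hN : seminorm N.
  apply: seminorm_add.
    exact: (seminorm_comp (T := fun y : Y => y.1) (cond_sn P)).
  exact: (seminorm_comp (T := fun y : Y => y.2) hr).
pose cu (u : 'rV[R]_n) : V := (0, vars c u).
have hcu : linear cu.
  exact: (linear_pair (@linear_0 R 'rV[R]_n E) (vars_linear c)).
pose T (u : 'rV[R]_n) : Y := (- cu u, (u, 0)).
have hT : linear T.
  exact: (linear_pair (linear_opp hcu)
    (linear_pair (@linear_id R 'rV[R]_n) (@linear_0 R 'rV[R]_n 'rV[R]_l))).
pose new f : 'rV[R]_l := \row_i f`_(m + i).
have hnew : linear new.
  by move=> a f g; apply/rowP => i; rewrite !mxE coefD coefZ.
pose emb (x : V) : Y := ((x.1, take_poly m x.2), (0, new x.2)).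
have hemb : linear emb.
  have h1 := @linear_fst R E {poly R}; have h2 := @linear_snd R E {poly R}.
  have htk : linear (fun f : {poly R} => take_poly m f).
    by move=> a u v; rewrite linearP.
  exact: (linear_pair (linear_pair h1 (linear_compose htk h2))
    (linear_pair (@linear_0 R V 'rV[R]_n) (linear_compose hnew h2))).
pose q x := qsn N T (emb x).
have hq : seminorm q := seminorm_comp (seminorm_qsn hN hT) hemb.
have Pt u : `|P (cu u) - t (u, 0)| <= 2 * e * l1 u := near u.
have qP b f : (size f <= m)%N -> q (b, f) = P (b, f).
  move=> fm; have f0 : new f = 0.
    apply/rowP => i; rewrite !mxE nth_default//.
    by apply: leq_trans fm _; rewrite leq_addr.
  rewrite /q /emb /= take_poly_id// f0.
  apply/eqP; rewrite eq_le; apply/andP; split.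
    by apply: le_trans (qsn_le0 hN hT _) _; rewrite /N /= (sn0 hr) addr0.
  apply: qsn_ge => u; rewrite /N /T /= -[(0, 0) + _]/(0 + u, 0 + 0) !add0r.
  rewrite /r /= (sn0 hl1l) addr0.
  have := Pt u; rewrite ler_norml => /andP[_].
  by have := snD (cond_sn P) ((b, f) - cu u) (cu u); rewrite subrK; lra.
have [||||Q [QP Qm Qe Qn]] := @refine_exact _ _ d P (m + l)%N q (cerr P) _ hq.
- exact: leq_addr.
- exact: qP.
- exact: cerr_gt0.
- exact: lexx.
exists Q; split; first exact: refines_trans QP PP0.
split=> [i i_n||_].
- by rewrite Qm; apply: leq_trans (cP i i_n) _; rewrite leq_addr.
- by rewrite Qe.
exists (fun i => m + i)%N; split=> [i il|u v]; first by rewrite Qm ltn_add2l.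
have tk : take_poly m (vars c u + @vars l (addn m) v) = vars c u.
  apply/polyP => i; rewrite coef_take_poly coefD.
  case: ltnP => im; last first.
    by rewrite nth_default//; apply: leq_trans (size_vars _ cP) im.
  rewrite [X in _ + X]coef_sum big1 ?addr0// => k _.
  by rewrite coefZ coefXn ltn_eqF ?mulr0// ltn_addr.
have nw : new (vars c u + @vars l (addn m) v) = v.
  apply/rowP => i; rewrite mxE coefD nth_default ?add0r; last first.
    by apply: leq_trans (size_vars _ cP) (leq_addr _ _).
  rewrite coef_sum (bigD1 i)//= big1 ?addr0.
    by rewrite coefZ coefXn eqxx mulr1.
  move=> k ki; rewrite coefZ coefXn eqn_add2l (_ : (_ == _) = false) ?mulr0//.
  by apply/negbTE; rewrite eq_sym.
rewrite Qn ler_norml /q /emb /= tk nw; apply/andP; split; last first.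
  rewrite lerBlDr; apply: le_trans (qsn_le T hN _ u) _.
  rewrite /N /T /= -/(cu u) subrr (sn0 (cond_sn P)) add0r.
  rewrite -[(0, v) + _]/(0 + u, v + 0) add0r addr0 /r /=.
  lra.
rewrite lerBrDr; apply: qsn_ge => w.
rewrite /N /T /= -/(cu u) -[(0, v) + _]/(0 + w, v + 0) add0r addr0 /r /=.
rewrite -(linB hcu).
have := Pt (u - w); rewrite ler_norml => /andP[h1 _].
have := snD ht (u - w, 0) (w, v).
rewrite -[_ + (w, v)]/(u - w + w, 0 + v) subrK add0r => h2.
have := ler_wpM2l e20 (snB hl1n u w); have := ler_wpM2l e20 (sn_ge0 hl1l v).
by rewrite !mulrDr; lra.
Qed.

Lemma realises_extension_meets n l c t e p Q :
  @realises_extension n l c t e Q -> meets p Q ->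
  (forall u, `|p (0, vars c u) - t (u, 0)| <= e * l1 u) ->
  exists g : nat -> nat, forall u v,
    `|p (0, vars c u + @vars l g v) - t (u, v)| <= 3 * e * (l1 u + l1 v).
Proof.
move=> [cQ eQ hQ] pQ pt.
have e0 : 0 <= e := le_trans (ltW (cerr_gt0 Q)) eQ.
have {}pQ f : (size f <= cstage Q)%N -> `|p (0, f) - Q (0, f)| <= e * l1p f.
  move=> fQ; have := pQ 0 f; rewrite size_poly0 (lin0 (comb_linear d)).
  move=> /(_ isT fQ)/le_trans; apply.
  by rewrite (sn0 (@seminorm_l1p R)) add0r ler_wpM2r// l1p_ge0.
have [u|g [gQ hg]] := hQ.
  have := pQ _ (size_vars u cQ); have := pt u.
  have : e * l1p (vars c u) <= e * l1 u.
    by apply: ler_wpM2l => //; apply: l1p_vars.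
  rewrite !ler_norml => ? /andP[? ?] /andP[? ?]; apply/andP; split; lra.
exists g => u v.
have := pQ _ (size_leD (size_vars u cQ) (size_vars v gQ)); have := hg u v.
have : e * l1p (vars c u + @vars l g v) <= e * (l1 u + l1 v).
  apply: ler_wpM2l => //.
  by apply: le_trans (l1pD _ _) _; apply: lerD; apply: l1p_vars.
by rewrite !ler_norml => ? /andP[? ?] /andP[? ?]; apply/andP; split; lra.
Qed.

End DenseSets.

(** * Omitting a non-isolated type *)

Section Omitting.
Variables (R : realType) (E : completeNormedModType R) (d : nat -> E).
Hypothesis ddense : forall x e, 0 < e -> exists n, `|x - d n| <= e.
Local Notation V := (E * {poly R})%type.
Variables (n : nat) (xi : ntype E n) (s : R).

Definition uniformly_close (m : nat) (e : R) (eta : ntype E n) :=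
  forall (b : 'rV[R]_m) (u : 'rV[R]_n),
    `|eta (comb d (rVpoly b), u) - xi (comb d (rVpoly b), u)|
      <= e * (l1 b + l1 u).

Lemma uniformly_close_nbhs m e : 0 < e ->
  exists (F : seq (formal_ext E n)) (e1 : R), 0 < e1 /\
    forall eta : ntype E n, (forall x, x \in F -> `|eta x - xi x| < e1) ->
      uniformly_close m e eta.
Proof.
move=> e0.
pose T (v : 'rV[R]_(m + n)) : formal_ext E n :=
  (comb d (rVpoly (lsubmx v)), rsubmx v).
have hT : linear T.
  have hl : linear (fun v : 'rV[R]_(m + n) => lsubmx v).
    by move=> a u v; rewrite linearP.
  have hr : linear (fun v : 'rV[R]_(m + n) => rsubmx v).
    by move=> a u v; rewrite linearP.
  exact: (linear_pair (linear_compose (comb_linear d)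
    (linear_compose (@rVpoly_linear R m) hl)) hr).
have hp := seminorm_comp (ntype_seminorm xi) hT.
have [C C0 hC] := sn_row_bound hp.
have [F [e1 [e10 hF]]] := seminorm_net (m + n) C e0.
exists [seq T v | v <- F], e1; split=> // eta heta b u.
have := hF _ _ hp (seminorm_comp (ntype_seminorm eta) hT) _ _ (row_mx b u).
rewrite l1_row_mx /T row_mxKl row_mxKr; apply.
  by move=> i; have := hC (delta_mx 0 i); rewrite l1_delta mulr1.
by move=> v vF; apply/ltW/heta; rewrite map_f.
Qed.

(** The negation of isolation, in the form used by amalgamation: the types that
    are near [xi] in the topology are not all near it in the metric. *)
Definition far_nearby := forall m e, 0 < e -> exists eta,
  uniformly_close m e eta /\ exists x, 3 * s * l1 x.2 < `|eta x - xi x|.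

(** The condition decides that the variables [c] are far from realising [xi],
    with a margin that covers the error allowed by the condition. *)
Definition omits (c : nat -> nat) (Q : cond E) :=
  exists (b : {poly R}) (u : 'rV[R]_n),
  [/\ (size b <= cstage Q)%N, forall i, (i < n)%N -> (c i < cstage Q)%N &
    s * l1 u + cerr Q * (l1p b + l1 u) <
      `|Q (comb d b, vars c u) - xi (comb d b, u)|].

Lemma omits_meets c p Q : omits c Q -> meets d p Q ->
  exists x : formal_ext E n, s * l1 x.2 < `|p (x.1, vars c x.2) - xi x|.
Proof.
move=> [b [u [bQ cQ hQ]]] /(_ _ _ bQ (size_vars u cQ)) hp.
exists (comb d b, u); rewrite /=.
have := ler_distD (p (comb d b, vars c u)) (Q (comb d b, vars c u))
  (xi (comb d b, u)).
have : cerr Q * (l1p b + l1p (vars c u)) <= cerr Q * (l1p b + l1 u).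
  by apply: ler_wpM2l; [exact: ltW (cerr_gt0 Q)|rewrite lerD2l l1p_vars].
by rewrite (distrC _ (p _)); lra.
Qed.

Hypotheses (s0 : 0 < s) (far : far_nearby).

(** When the condition [P] leaves the variables [c] close to realising
    [xi], amalgamate it with a type [eta] that nearly agrees with [xi] on
    the vectors that [P] speaks of but is at distance more than [3 * s]
    from [xi]: the seminorm changes little on these vectors, and the
    variables now have a type within [2 * s] of [eta]. *)
Lemma omitting_amalgam (c : nat -> nat) (P : cond E) :
  (forall x : formal_ext E n, `|P (x.1, vars c x.2) - xi x| <= s * l1 x.2) ->
  exists q : V -> R, [/\ seminorm q, forall b : E, q (b, 0) = `|b|,
    within d q P (cstage P) (cerr P / 2) &
    exists x : formal_ext E n, s * l1 x.2 < `|q (x.1, vars c x.2) - xi x|].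
Proof.
move=> near; pose m := cstage P.
pose e := Num.min s (cerr P / 2).
have e0 : 0 < e by rewrite lt_min s0 divr_gt0// cerr_gt0.
have es : e <= s by rewrite ge_min lexx.
have eP : e <= cerr P / 2 by rewrite ge_min lexx orbT.
have [eta [etaxi [x0 x0far]]] := far m e0.
have heta := ntype_seminorm eta; have hxi := ntype_seminorm xi.
have hl1m := @seminorm_l1 R m; have hl1n := @seminorm_l1 R n.
have s20 : 0 <= 2 * s by lra.
pose X := formal_ext E n.
pose Y := ((V * 'rV[R]_m) * X)%type.
pose N (y : Y) := P y.1.1 + e * l1 y.1.2 + (eta y.2 + 2 * s * l1 y.2.2).
have hN : seminorm N.
  apply: seminorm_add; apply: seminorm_add.
  - exact: (seminorm_comp (T := fun y : Y => y.1.1) (cond_sn P)).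
  - exact: (seminorm_scale (ltW e0)
      (seminorm_comp (T := fun y : Y => y.1.2) hl1m _)).
  - exact: (seminorm_comp (T := fun y : Y => y.2) heta).
  - exact: (seminorm_scale s20
      (seminorm_comp (T := fun y : Y => y.2.2) hl1n _)).
pose D (b : 'rV[R]_m) : E := comb d (rVpoly b).
have hD : linear D := linear_compose (comb_linear d) (@rVpoly_linear R m).
pose Z := ('rV[R]_m * 'rV[R]_n)%type.
pose T (z : Z) : Y := (((- D z.1, - vars c z.2), z.1), (D z.1, z.2)).
have hT : linear T.
  have h1 := @linear_fst R 'rV[R]_m 'rV[R]_n.
  have h2 := @linear_snd R 'rV[R]_m 'rV[R]_n.
  have hD1 := linear_compose hD h1.
  have hc2 := linear_compose (vars_linear c) h2.
  exact: (linear_pair (linear_pair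
    (linear_pair (linear_opp hD1) (linear_opp hc2)) h1) (linear_pair hD1 h2)).
pose emb (v : V) : Y := (((0, v.2), 0), (v.1, 0)).
have hemb : linear emb.
  have h1 := @linear_fst R E {poly R}; have h2 := @linear_snd R E {poly R}.
  exact: (linear_pair (linear_pair (linear_pair (@linear_0 R V E) h2)
    (@linear_0 R V 'rV[R]_m)) (linear_pair h1 (@linear_0 R V 'rV[R]_n))).
(* The error term in [b : 'rV_m] compensates the discrepancy between [eta] and
   [xi] on the vectors of stage [m]; the term [2 * s * l1] compensates it on the
   variables, together with the distance at most [s] from [xi] to the type that
   the variables have according to [P]. *)
pose q v := qsn N T (emb v).
have hq : seminorm q := seminorm_comp (seminorm_qsn hN hT) hemb.
have NE b f z : N (emb (b, f) + T z) = P (- D z.1, f - vars c z.2) +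
    e * l1 z.1 + (eta (b + D z.1, z.2) + 2 * s * l1 z.2).
  by rewrite /N /emb /T /= -[(0, f) + _]/(0 + _, f - _)
    -[(b, 0) + _]/(b + _, 0 + _) !add0r.
have near' b u : `|P (b, vars c u) - xi (b, u)| <= s * l1 u := near (b, u).
have etaxi' b u : `|eta (D b, u) - xi (D b, u)| <= e * (l1 b + l1 u).
  exact: etaxi.
have q_P (g : 'rV[R]_m) f : `|q (D g, f) - P (D g, f)| <= e * l1 g.
  rewrite ler_norml lerBrDr lerBlDr; apply/andP; split.
    apply: qsn_ge => -[b u]; rewrite NE /= -(linD hD).
    have := etaxi' (g + b) u; have := near' (D (g + b)) u.
    rewrite !ler_norml => /andP[h1 h2] /andP[h3 h4].
    have := snD (cond_sn P) (- D b, f - vars c u) (D (g + b), vars c u).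
    rewrite -[X in P X <= _]/(- D b + D (g + b), f - vars c u + vars c u) subrK.
    rewrite (linD hD) addrCA addNr addr0 -(linD hD) => h5.
    have := ler_wpM2l (ltW e0) (snD hl1m g b).
    have := ler_wpM2r (sn_ge0 hl1n u) es.
    by move: h3 h4; rewrite !mulrDr; lra.
  apply: le_trans (qsn_le T hN _ (- g, 0)) _; rewrite NE /=.
  rewrite (lin0 (vars_linear c)) (linN hD) opprK subr0 subrr (snN hl1m).
  by rewrite (sn0 hl1n) mulr0 addr0 (sn0 heta) addr0 addrC.
have q_eta b u : `|q (b, vars c u) - eta (b, u)| <= 2 * s * l1 u.
  rewrite ler_norml lerBrDr lerBlDr; apply/andP; split.
    apply: qsn_ge => -[g w]; rewrite NE /= -(linB (vars_linear c)) -(linN hD).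
    have := etaxi' (- g) (u - w); have := near' (D (- g)) (u - w).
    rewrite (snN hl1m) !ler_norml => /andP[h1 h2] /andP[h3 h4].
    have := snD heta (D (- g), u - w) (b + D g, w).
    rewrite -[X in eta X <= _]/(D (- g) + (b + D g), u - w + w) subrK.
    rewrite (linN hD) addrCA addNr addr0 -(linN hD) => h5.
    have := ler_wpM2l (ltW s0) (snB hl1n u w).
    have := ler_wpM2r (sn_ge0 hl1n (u - w)) es.
    by move: h3 h4; rewrite !mulrDr; lra.
  apply: le_trans (qsn_le T hN _ (0, u)) _; rewrite NE /=.
  rewrite (lin0 hD) subrr oppr0 (sn0 hl1m) mulr0 addr0.
  by rewrite (sn0 (cond_sn P)) add0r addr0 addrC.
exists q; split=> //.
- move=> b; have := q_eta b 0.
  rewrite (lin0 (vars_linear c)) (sn0 hl1n) mulr0 normr_le0 subr_eq0 => /eqP->.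
  exact: ntype_extends.
- move=> b f bm fm; have := q_P (poly_rV b) f.
  rewrite /D poly_rV_K// -l1p_rVpoly poly_rV_K// => /le_trans; apply.
  apply: le_trans (ler_wpM2r (l1p_ge0 b) eP) _.
  rewrite mulrDr lerDl; apply: mulr_ge0 (l1p_ge0 f).
  by rewrite divr_ge0// ltW// cerr_gt0.
- exists x0; case: x0 x0far => b u /= x0far; have := q_eta b u.
  have := ler_distD (q (b, vars c u)) (eta (b, u)) (xi (b, u)).
  by rewrite (distrC _ (q _)); lra.
Qed.

Lemma omits_dense (c : nat -> nat) (P : cond E) :
  exists Q, refines d Q P /\ omits c Q.
Proof.
have [P1 [P1P cP1 _]] := shrink d P (\max_(i < n) (c i).+1) (@ltr01 R).
have cP i : (i < n)%N -> (c i < cstage P1)%N.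
  move=> i_n; apply: leq_trans cP1.
  exact: (leq_bigmax (F := fun i : 'I_n => (c i).+1) (Ordinal i_n)).
have eP10 := cerr_gt0 P1.
have [q [hq qE qP [[b u] /= far_bu]]] :
  exists q : V -> R, [/\ seminorm q, forall b : E, q (b, 0) = `|b|,
    within d q P1 (cstage P1) (cerr P1 / 2) &
    exists x : formal_ext E n, s * l1 x.2 < `|q (x.1, vars c x.2) - xi x|].
  have [near|/existsNP[x /negP]] := pselect
    (forall x : formal_ext E n, `|P1 (x.1, vars c x.2) - xi x| <= s * l1 x.2).
    exact: omitting_amalgam.
  rewrite -ltNge => hx; exists P1; split; [exact: cond_sn|exact: cond_ext| |].
    by apply: within_exact => //; rewrite divr_ge0// ltW.
  by exists x.
pose D := `|q (b, vars c u) - xi (b, u)| - s * l1 u.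
have D0 : 0 < D by rewrite subr_gt0.
have [|i hi] := @ddense b (D / 4); first lra.
have l1u := sn_ge0 (@seminorm_l1 R n) u.
have C0 : 0 < 1 + l1 u by rewrite ltr_pwDl.
pose e := Num.min (cerr P1 / 2) (D / 4 / (1 + l1 u)).
have e0 : 0 < e by rewrite lt_min !divr_gt0.
have eC : e * (1 + l1 u) <= D / 4.
  by rewrite -ler_pdivlMr// ge_min lexx orbT.
have eP : e <= cerr P1 / 2 by rewrite ge_min lexx.
pose Q := Cond (maxn (cstage P1) i.+1) hq qE e0.
exists Q; split.
  apply: refines_trans P1P; split=> /=; [by rewrite leq_maxl|lra|].
  move=> f g fm gm; apply: le_trans (qP f g fm gm) _.
  by apply: ler_wpM2r; [rewrite addr_ge0// l1p_ge0|lra].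
exists 'X^i, u; split=> /=; first by rewrite size_polyXn leq_maxr.
  by move=> k /cP h; apply: leq_trans h _; rewrite leq_maxl.
rewrite combXn l1pXn.
have h1 := le_trans (cond_lip Q b (d i) (vars c u)) hi.
have h2 : `|xi (b, u) - xi (d i, u)| <= D / 4.
  apply: le_trans (sn_dist (ntype_seminorm xi) _ _) _.
  by rewrite -[(b, u) - _]/(b - d i, u - u) subrr ntype_extends.
rewrite -[cnorm Q]/q in h1.
have := ler_distD (q (d i, vars c u)) (q (b, vars c u)) (xi (b, u)).
have := ler_distD (xi (d i, u)) (q (d i, vars c u)) (xi (b, u)).
rewrite (distrC (xi (d i, u)) (xi (b, u))).
by rewrite /D in D0 eC h1 h2 *; lra.
Qed.

End Omitting.

Lemma not_isolated_far (R : realType) (E : completeNormedModType R)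
    (d : nat -> E) n (xi : ntype E n) :
  ~ isolated_type xi -> exists2 s, 0 < s & far_nearby d xi s.
Proof.
move=> /existsNP[W /not_implyP[[r /= r0 rW] nW]].
exists (r / 6); first lra.
move=> m e e0; apply: contrapT => nex; apply: nW.
have [F [e1 [e10 hF]]] := uniformly_close_nbhs d xi m e0.
apply: (@filterS _ (nbhs xi) (nbhs_filter xi)) (ntype_nbhs xi F e10).
move=> eta heta.
apply: rW => /=; apply: (@le_lt_trans _ _ (r / 2)%:E); last first.
  by rewrite lte_fin; lra.
apply: type_dist_le => [|x]; first lra.
rewrite distrC leNgt; apply/negP => hx; apply: nex; exists eta.
split; first exact: hF.
by exists x; have -> : 3 * (r / 6) = r / 2 by lra.
Qed.

(** * Generic Gurarij spaces *)

Section GenericGurarij.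
Variables (R : realType) (E : completeNormedModType R) (d : nat -> E).
Local Notation V := (E * {poly R})%type.

Hypothesis ddense : forall x e, 0 < e -> exists n, `|x - d n| <= e.

Definition pair_sn n l (t : 'rV[R]_(n + l) -> R)
    (w : 'rV[R]_n * 'rV[R]_l) : R :=
  t (row_mx w.1 w.2).

Lemma seminorm_pair_sn n l (t : 'rV[R]_(n + l) -> R) :
  seminorm t -> seminorm (pair_sn t).
Proof.
move=> ht; apply: (seminorm_comp ht) => a u v.
by rewrite scale_row_mx add_row_mx.
Qed.

(** The first clause makes the variables dense in the completion; the second is
    the property of Gurarij spaces restricted to spans of variables, with an
    error in l1 norm. *)
Definition rich (p : V -> R) :=
  (forall (x : V) e, 0 < e -> exists g : nat, p (x - (0, 'X^g)) <= e) /\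
  (forall n l e, 0 < e -> exists e', 0 < e' /\
    forall (c : nat -> nat) (t : 'rV[R]_(n + l) -> R), seminorm t ->
    (forall u, `|p (0, vars c u) - t (row_mx u 0)| <= e' * l1 u) ->
    exists g : nat -> nat, forall (u : 'rV[R]_n) (v : 'rV[R]_l),
      `|p (0, vars c u + vars g v) - t (row_mx u v)| <= e * (l1 u + l1 v)).

Lemma rational_approx (x e : R) : 0 < e -> exists r : rat, `|x - ratr r| <= e.
Proof.
move=> e0; have [|r] := @rat_in_itvoo R (x - e) (x + e); first lra.
by rewrite in_itv /= => /andP[? ?]; exists r; rewrite ler_norml; apply/andP;
  split; lra.
Qed.

Lemma rational_poly (p : V -> R) (f : {poly R}) e : seminorm p -> 0 < e ->
  exists r : seq rat, p (0, f - Poly (map ratr r)) <= e.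
Proof.
move=> hp e0; pose S := \sum_(i < size f) p (0, 'X^i) + 1.
have S0 : 0 < S by rewrite ltr_wpDl// sumr_ge0// => i _; apply: sn_ge0.
have /choice[r hr] : forall i, exists r : rat, `|f`_i - ratr r| <= e / S.
  by move=> i; apply: rational_approx; rewrite divr_gt0.
exists (mkseq r (size f)); set g := Poly _.
have gE i : (i < size f)%N -> g`_i = ratr (r i).
  by move=> i_f; rewrite coef_Poly (nth_map 0) ?size_mkseq// nth_mkseq.
have fgE : f - g = \sum_(i < size f) (f - g)`_i *: 'X^i.
  have combX (h : {poly R}) : comb (fun i => 'X^i) h = h.
    by rewrite /comb -poly_def coefK.
  rewrite -[LHS]combX; apply: comb_widen.
  rewrite (leq_trans (size_polyD _ _))// geq_max leqnn size_polyN.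
  by rewrite (leq_trans (size_Poly _))// size_map size_mkseq.
have emb : linear (fun f : {poly R} => (0 : E, f)).
  exact: (linear_pair (@linear_0 R {poly R} E) (@linear_id R {poly R})).
have hp2 := seminorm_comp hp emb.
rewrite fgE; apply: le_trans (sn_sum hp2 _ _) _.
apply: (@le_trans _ _ (e / S * \sum_(i < size f) p (0, 'X^i))).
  rewrite mulr_sumr; apply: ler_sum => i _; rewrite (snZ hp2).
  by apply: ler_wpM2r; [exact: sn_ge0|rewrite coefB gE].
rewrite mulrAC ler_pdivrMr// ler_wpM2l ?(ltW e0)//.
by rewrite /S lerDl.
Qed.

(** Rational combinations and a countable dense set of seminorms suffice, so
    that richness amounts to meeting countably many dense sets, to which the
    sets [O] can be added. *)
Lemma generic_rich (O : nat -> cond E -> Prop) :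
  (forall i P, exists Q, refines d Q P /\ O i Q) ->
  exists p : V -> R, [/\ seminorm p, forall b, p (b, 0) = `|b|, rich p &
    forall i, exists Q, O i Q /\ meets d p Q].
Proof.
move=> Odense.
pose t n := projT1 (cid (@seminorm_separable R n)).
have ht n : (forall i, seminorm (t n i)) /\
    forall p e, seminorm p -> 0 < e ->
      exists i, forall v : 'rV[R]_n, `|p v - t n i v| <= e * l1 v.
  exact: projT2 (cid (@seminorm_separable R n)).
pose I := (nat * seq rat * nat + nat * nat * seq nat * nat * nat + nat)%type.
pose D (i : I) (Q : cond E) := match i with
  | inl (inl (i, r, k)) => near_variable d i (Poly (map ratr r)) k.+1%:R^-1 Q
  | inl (inr (n, l, c, i, k)) => @realises_extension R E n l (nth 0%N c)
      (pair_sn (t (n + l)%N i)) k.+1%:R^-1 Q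
  | inr i => O i Q
  end.
have Ddense i P : exists Q, refines d Q P /\ D i Q.
  case: i => [[[[i r] k]|[[[[n l] c] i] k]]|i] /=.
  - by apply: near_variable_dense; rewrite invr_gt0.
  - apply: amalgam_dense; last by rewrite invr_gt0.
    by apply: seminorm_pair_sn; case: (ht (n + l)%N).
  - exact: Odense.
have [|p [hp pE pD]] := @generic_seminorm R E d ddense
    (fun k Q => if unpickle k is Some i then D i Q else True).
  move=> k P; case: (unpickle k) => [i|]; first exact: Ddense.
  have [Q [QP _]] := Odense 0%N P; by exists Q.
have {}pD i : exists Q, D i Q /\ meets d p Q.
  by have := pD (pickle i); rewrite pickleK.
exists p; split=> //; last by move=> i; exact: (pD (inr i)).
split=> [[b f] e e0|n l e e0].
  have e30 : 0 < e / 3 by lra.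
  have [i bi] := ddense b e30; have [r fr] := rational_poly f hp e30.
  have [k /(_ k (leqnn k)) hk] := inv_small e30.
  have [Q [DQ pQ]] := pD (inl (inl (i, r, k))).
  have [g hg] := near_variable_meets DQ pQ; exists g.
  set h := Poly _ in fr hg.
  have -> : (b, f) - (0, 'X^g) = (d i, h - 'X^g) + ((0, f - h) + (b - d i, 0)).
    rewrite -[RHS]/(d i + (0 + (b - d i)), h - 'X^g + (f - h + 0)).
    rewrite -[LHS]/(b - 0, f - 'X^g) add0r subrKC addr0 subr0.
    by rewrite [h - _ + _]addrC subrKA.
  have := snD hp (d i, h - 'X^g) ((0, f - h) + (b - d i, 0)).
  have := snD hp (0, f - h) (b - d i, 0); rewrite pE.
  by have := le_trans hg hk; lra.
have [|k /(_ k (leqnn k)) hk] := @inv_small R (e / 4); first lra.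
have : 0 < k.+1%:R^-1 :> R by rewrite invr_gt0.
set e1 : R := k.+1%:R^-1 in hk *; move=> e10.
exists (e1 / 2); split=> [|c tau htau ptau]; first lra.
have e20 : 0 < e1 / 2 by lra.
have [tsn /(_ tau _ htau e20)[i hi]] := ht (n + l)%N.
have [Q [DQ pQ]] := pD (inl (inr (n, l, mkseq c n, i, k))).
have cE u : vars (nth 0%N (mkseq c n)) u = @vars R n c u.
  by apply: eq_bigr => a _; rewrite nth_mkseq.
have [u|g hg] := realises_extension_meets DQ pQ.
  rewrite cE /pair_sn /=; have := ptau u; have := hi (row_mx u 0).
  rewrite l1_row_mx (sn0 (@seminorm_l1 R l)) addr0 -/e1 !ler_norml.
  by move=> /andP[? ?] /andP[? ?]; apply/andP; split; lra.
exists g => u v; have := hg u v; have := hi (row_mx u v).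
rewrite cE /pair_sn l1_row_mx -/e1 /=.
have l0 : 0 <= l1 u + l1 v by rewrite addr_ge0// sn_ge0//; apply: seminorm_l1.
have := ler_wpM2r l0 hk.
rewrite !ler_norml => ? /andP[? ?] /andP[? ?]; apply/andP; split; lra.
Qed.

End GenericGurarij.

Section RichCompletion.
Variables (R : realType) (E : completeNormedModType R).
Local Notation V := (E * {poly R})%type.
Variables (p : V -> R) (hp : seminorm p) (prich : rich p).
Local Notation H := (completion hp : completeNormedModType R).

Definition var (g : nat) : H := cembed hp (0, 'X^g).

Lemma var_dense (y : H) e : 0 < e -> exists g, `|y - var g| <= e.
Proof.
move=> e0; have e20 : 0 < e / 2 by lra.
have [v yv] := completion_dense y e20; have [g vg] := prich.1 v _ e20.
exists g; have := ler_distD (cembed hp v) y (var g).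
by rewrite -(linB (cembed_linear hp)) norm_cembed; lra.
Qed.

Lemma sum_var n (c : nat -> nat) (u : 'rV[R]_n) :
  \sum_(i < n) u 0 i *: var (c i) = cembed hp (0, vars c u).
Proof.
have hf : linear (fun f : {poly R} => cembed hp (0, f)).
  exact: (linear_compose (cembed_linear hp)
    (linear_pair (@linear_0 R {poly R} E) (@linear_id R {poly R}))).
have [F hF] := lin_bundle hf; rewrite -(hF (vars c u)) /vars linear_sum.
by apply: eq_bigr => i _; rewrite linearZZ hF.
Qed.

Lemma sum_near_vars n (h : 'I_n -> H) (c : nat -> nat) e (u : 'rV[R]_n) :
  (forall i : 'I_n, `|h i - var (c i)| <= e) ->
  `|\sum_(i < n) u 0 i *: h i - cembed hp (0, vars c u)| <= e * l1 u.
Proof.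
move=> hc; rewrite -sum_var -sumrB; apply: le_trans (ler_norm_sum _ _ _) _.
rewrite /l1 mulr_sumr; apply: ler_sum => i _.
by rewrite -scalerBr normrZ mulrC; apply: ler_wpM2r (hc i).
Qed.

Lemma var_choice n (h : 'I_n -> H) e : 0 < e ->
  exists c : nat -> nat, forall i : 'I_n, `|h i - var (c i)| <= e.
Proof.
move=> e0.
have /choice[c hc] : forall k : nat, exists g, forall i : 'I_n, i = k :> nat ->
    `|h i - var g| <= e.
  move=> k; have [kn|kn] := ltnP k n.
    have [g hg] := var_dense (h (Ordinal kn)) e0; exists g => i ik.
    by rewrite (_ : i = Ordinal kn)//; apply: val_inj.
  by exists 0%N => i ik; move: (ltn_ord i); rewrite ik ltnNge kn.
by exists c => i; apply: hc.
Qed.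

(** Richness only applies to variables, so the image of a basis of [E1] is first
    approximated by variables.  A basis of a complement of [E1] in [F1] is then
    sent to the variables that richness provides, while the given embedding is
    kept on [E1].  The error, controlled in l1 norm, is small for the norm of
    [F1] as well, because all norms are equivalent in finite dimension. *)
Lemma rich_gurarij : gurarij H.
Proof.
move=> eps eps0 E1 F1 j phi fE1 fF1.
have [|n [M [hM Minj Msurj]]] :=
  @finite_dim_complement R E1 0 (fun=> 0) fE1 (@linear_0 R 'rV[R]_0 E1).
  by move=> u _; apply/rowP => -[].
have {}Minj u : M u = 0 -> u = 0.
  by move=> Mu; have [|//] := Minj 0 u; rewrite add0r.
have {}Msurj x : exists u, x = M u.
  by have [_ [u ->]] := Msurj x; exists u; rewrite add0r.
have hj : linear j := embP j.
have hphi : linear phi := embP phi.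
have hL : linear (fun u => j (M u)) := linear_compose hj hM.
have Linj u : j (M u) = 0 -> u = 0.
  by move=> /eqP; rewrite -normr_eq0 emb_isometric normr_eq0 => /eqP/Minj.
have [l [K [hK LKinj LKsurj]]] := finite_dim_complement fF1 hL Linj.
have hlsub : linear (fun v : 'rV[R]_(n + l) => lsubmx v).
  by move=> a u v; rewrite linearP.
have hrsub : linear (fun v : 'rV[R]_(n + l) => rsubmx v).
  by move=> a u v; rewrite linearP.
pose B (v : 'rV[R]_(n + l)) := j (M (lsubmx v)) + K (rsubmx v).
have hB : linear B.
  exact: (linear_add (linear_compose hL hlsub) (linear_compose hK hrsub)).
have Binj v : B v = 0 -> v = 0.
  by move=> /LKinj[lv rv]; rewrite -[v]hsubmxK lv rv row_mx0.
have BE u w : B (row_mx u w) = j (M u) + K w.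
  by rewrite /B row_mxKl row_mxKr.
have /choice[co coE] : forall x : F1, exists v, x = B v.
  move=> x; have [u [w ->]] := LKsurj x; exists (row_mx u w).
  by rewrite BE.
have hco : linear co.
  move=> a x y; apply/eqP; rewrite -subr_eq0; apply/eqP/Binj.
  by rewrite (linB hB) (linD hB) (linZ hB) -!coE subrr.
have [C C0 hC] := coord_bound hB Binj.
have e0 : 0 < eps / C / 2 by rewrite !divr_gt0.
have [e' [e'0 ext]] := prich.2 n l _ e0.
pose e1 := Num.min e' (eps / C / 2).
have e10 : 0 < e1 by rewrite lt_min e'0.
have [c hc] := var_choice (fun i => phi (M (delta_mx 0 i))) e10.
have phiM u : phi (M u) = \sum_(i < n) u 0 i *: phi (M (delta_mx 0 i)).
  exact: lin_rowE (linear_compose hphi hM) u.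
have near u : `|phi (M u) - cembed hp (0, vars c u)| <= e1 * l1 u.
  by rewrite phiM; apply: sum_near_vars.
have ht : seminorm (fun v => `|B v|) := seminorm_comp (seminorm_norm F1) hB.
have [u|g hg] := ext c _ ht.
  rewrite BE (lin0 hK) addr0 emb_isometric -(emb_isometric phi) distrC.
  rewrite -(norm_cembed hp); apply: le_trans (ler_dist_dist _ _) _.
  apply: le_trans (near u) _; apply: ler_wpM2r.
    by apply: sn_ge0; apply: seminorm_l1.
  by rewrite ge_min lexx.
pose psi (x : F1) : H := phi (M (lsubmx (co x))) +
  cembed hp (0, vars g (rsubmx (co x))).
have hpsi : linear psi.
  have hv : linear (fun v : 'rV[R]_l => cembed hp (0, vars g v)).
    exact: (linear_compose (cembed_linear hp)
      (linear_pair (@linear_0 R 'rV[R]_l E) (vars_linear g))).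
  exact: (linear_add (linear_compose (linear_compose hphi hM)
    (linear_compose hlsub hco)) (linear_compose hv (linear_compose hrsub hco))).
have [psi' psiE] := lin_bundle hpsi; exists psi'; split=> [x|x].
  have [u ->] := Msurj x; rewrite psiE /psi.
  have -> : co (j (M u)) = row_mx u 0.
    apply/eqP; rewrite -subr_eq0; apply/eqP/Binj.
    by rewrite (linB hB) -coE BE (lin0 hK) addr0 subrr.
  rewrite row_mxKl row_mxKr (lin0 (vars_linear g)).
  by rewrite -[(0, 0)]/(0 : V) (lin0 (cembed_linear hp)) addr0.
set u := lsubmx (co x); set w := rsubmx (co x).
have l1E : l1 u + l1 w = l1 (co x) by rewrite -l1_row_mx hsubmxK.
have xE : x = B (row_mx u w) by rewrite hsubmxK.
have h1 := hg u w; rewrite -xE l1E -(norm_cembed hp) in h1.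
have h2 : `|psi' x - cembed hp (0, vars c u + vars g w)| <=
    eps / C / 2 * l1 (co x).
  have -> : psi' x - cembed hp (0, vars c u + vars g w) =
      phi (M u) - cembed hp (0, vars c u).
    rewrite psiE /psi -/u -/w.
    have -> : cembed hp (0, vars c u + vars g w) =
        cembed hp (0, vars c u) + cembed hp (0, vars g w).
      rewrite -(linD (cembed_linear hp)).
      by rewrite -[X in _ = cembed hp X]/(0 + 0, _) addr0.
    by rewrite opprD addrACA subrr addr0.
  apply: le_trans (near u) _; apply: ler_pM.
  - exact: ltW.
  - by apply: sn_ge0; apply: seminorm_l1.
  - by rewrite ge_min lexx orbT.
  - by rewrite -l1E lerDl; apply: sn_ge0; apply: seminorm_l1.
have h3 : eps / C * l1 (co x) <= eps * `|x|.
  rewrite mulrAC ler_pdivrMr// -mulrA ler_pM2l// mulrC.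
  by have := hC (co x); rewrite -coE.
have := ler_dist_dist (psi' x) (cembed hp (0, vars c u + vars g w)).
move: h1; rewrite !ler_norml => /andP[? ?] /andP[? ?].
by apply/andP; split; lra.
Qed.

Lemma base_embedding : (forall b : E, p (b, 0) = `|b|) ->
  exists k : embedding E H, forall b, k b = cembed hp (b, 0).
Proof.
move=> pE; have hk : linear (fun b : E => cembed hp (b, 0)).
  exact: (linear_compose (cembed_linear hp)
    (linear_pair (@linear_id R E) (@linear_0 R E {poly R}))).
have [k kE] := lin_bundle hk.
have kiso b : `|k b| = `|b| by rewrite kE norm_cembed pE.
by exists (Embedding kiso).
Qed.

Lemma rich_separable : separable (completion hp).
Proof. exact: seq_separable var_dense. Qed.

End RichCompletion.

(** * The characterisation *)

(** For each ball of a countable basis of [H] that meets the image of [G], one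
    point of [G] mapped into this ball is selected. *)
Lemma separable_isometric (R : realType) (G H : completeNormedModType R)
    (f : embedding G H) : separable H -> separable G.
Proof.
move=> /separable_seq[h hdense].
have /choice[x hx] : forall c : nat, exists x : G, forall n k y,
    unpickle c = Some (n, k) -> `|f y - h n| <= k.+1%:R^-1 ->
    `|f x - h n| <= k.+1%:R^-1.
  move=> c; case Ec : (unpickle c) => [[n k]|]; last by exists 0.
  have [[y hy]|ny] := pselect (exists y, `|f y - h n| <= k.+1%:R^-1).
    by exists y => n' k' y' [<- <-].
  by exists 0 => n' k' y [<- <-] hy; case: ny; exists y.
apply: (@seq_separable _ _ x) => y e e0.
have [|k /(_ k (leqnn k)) hk] := @inv_small R (e / 2); first lra.
have [|n hn] := hdense (f y) k.+1%:R^-1; first by rewrite invr_gt0.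
exists (pickle (n, k)).
have hxn := hx (pickle (n, k)) n k y (pickleK _) hn.
rewrite -(emb_isometric f) linearB.
have := ler_distD (h n) (f y) (f (x (pickle (n, k)))).
rewrite (distrC (h n)) => /le_trans; apply.
apply: le_trans (lerD hn hxn) _; apply: le_trans (lerD hk hk) _; lra.
Qed.

Section PrimeAtomic.
Variables (R : realType) (E G : completeNormedModType R) (j : embedding E G).
Hypotheses (hE : separable E) (jprime : prime_over j).

Lemma prime_separable : separable G.
Proof.
have [d ddense] := separable_seq hE.
have [|p [hp pE prich _]] := @generic_rich _ _ _ ddense (fun _ _ => True).
  by move=> _ P; have [Q [QP _ _]] := shrink d P 0 (@ltr01 R); exists Q.
have [k kE] := base_embedding hp pE.
have [f _] := jprime k (rich_gurarij prich).
exact: separable_isometric f (rich_separable hp prich).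
Qed.

(** A non-isolated type of a tuple of [G] would be omitted by a generic Gurarij
    space over [E], into which [G] embeds over [E]. *)
Lemma prime_atomic : atomic_over j.
Proof.
move=> n a; apply: contrapT => niso.
have [d ddense] := separable_seq hE.
have [s s0 far] := not_isolated_far d niso.
pose O i (Q : cond E) := if unpickle i is Some c then
  omits d (tp j a) s (nth 0%N c) Q else True.
have [|p [hp pE prich pO]] := @generic_rich _ _ _ ddense O.
  move=> i P; rewrite /O; case: (unpickle i) => [c|].
    exact: omits_dense.
  by have [Q [QP _ _]] := shrink d P 0 (@ltr01 R); exists Q.
have [k kE] := base_embedding hp pE.
have [f fj] := jprime k (rich_gurarij prich).
have [c hc] := var_choice prich (fun i => f (a i)) s0.
have [Q []] := pO (pickle (mkseq c n)); rewrite /O pickleK => Qomits pQ.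
have [x] := omits_meets Qomits pQ.
have cE : vars (nth 0%N (mkseq c n)) x.2 = vars c x.2.
  by apply: eq_bigr => i _; rewrite nth_mkseq.
rewrite cE ltNge => /negP; apply.
have -> : tp j a x = `|k x.1 + \sum_(i < n) x.2 0 i *: f (a i)|.
  rewrite /= /eval_tuple -(emb_isometric f) linearD linear_sum fj /=.
  by congr (`|_ + _|); apply: eq_bigr => i _; rewrite linearZZ.
have -> : p (x.1, vars c x.2) = `|k x.1 + cembed hp (0, vars c x.2)|.
  rewrite kE -(linD (cembed_linear hp)) norm_cembed.
  by rewrite -[X in _ = p X]/(x.1 + 0, 0 + vars c x.2) addr0 add0r.
apply: le_trans (ler_dist_dist _ _) _.
rewrite opprD addrACA subrr add0r distrC.
exact: sum_near_vars.
Qed.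

End PrimeAtomic.

Theorem corollary2p13 (R : realType) (E G : completeNormedModType R)
    (j : embedding E G) (hG : gurarij G) (hE : separable E) :
  prime_over j <-> (separable G /\ atomic_over j).
Proof.
split=> [jprime|[]]; last exact: separable_atomic_prime.
by split; [exact: prime_separable jprime|exact: prime_atomic jprime].
Qed.
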